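(* Let $\Sigma=(\mathbf{x},\mathbf{F})$ be an LP seed of rank $n$ with $\hat F_j=F_j$ for all $j\in[1,n]$, and let $\Sigma'=\mu_k(\Sigma)$ for some $k\in[1,n]$. Then $\mathcal{U}(\Sigma)=\mathcal{U}(\Sigma')$.
   Context: $R$ is a unique factorization domain containing $\mathbb{Z}$ and $\mathcal{F}$ is the field of rational functions in $n$ variables over $\mathrm{Frac}(R)$. For a rational function $F$, write $x_i\in F$ if $F$ involves $x_i$. An LP seed of rank $n$ is a pair $(\mathbf{x},\mathbf{F})$ where $\mathbf{x}=\{x_1,\dots,x_n\}$ is a transcendence basis of $\mathcal{F}$ over $\mathrm{Frac}(R)$ and $\mathbf{F}=\{F_1,\dots,F_n\}$ are irreducible polynomials in $R[x_1,\dots,x_n]$ with $x_j\nmid F_i$ for all $i,j$ and $F_i$ not involving $x_i$. The exchange Laurent polynomial is $\hat F_j=F_j/\prod_{k\neq j}x_k^{a_k}$, with $a_k\in\mathbb{Z}_{\ge0}$ maximal such that $F_k^{a_k}$ divides $F_j|_{x_k\leftarrow F_k/x'_k}$ in $R[x_1,\dots,x_{k-1},(x'_k)^{-1},x_{k+1},\dots,x_n]$. LP mutation in direction $k$: $\mu_k(\mathbf{x},\mathbf{F})=(\mathbf{x}',\mathbf{F}')$ with $x'_k=\hat F_k/x_k$, $x'_i=x_i$ ($i\ne k$); $F'_k=F_k$; if $x_k\notin F_i$ then $F'_i=F_i$ (up to a unit); if $x_k\in F_i$, put $N_k=(\hat F_k|_{x_i\leftarrow0})/x'_k$, $G_i=F_i|_{x_k\leftarrow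 N_k}$, let $H_i$ be $G_i$ with all common factors (in $R[x_1,\dots,\widehat{x_i},\dots,\widehat{x_k},\dots,x_n]$) with $\hat F_k|_{x_i\leftarrow0}$ removed, and $F'_i=MH_i$ with $M$ a Laurent monomial in $\{x'_j\}_{j\ne i}$ with unit coefficient such that $F'_i\in R[x'_1,\dots,x'_n]$ is not divisible by any $x'_j$. The result is an LP seed. For an LP seed $\Sigma=(\mathbf{x},\mathbf{F})$ set $x'_j=\hat F_j/x_j$ and $\mathbf{x}_j=(\mathbf{x}\setminus\{x_j\})\cup\{x'_j\}$; the upper bound is $\mathcal{U}(\Sigma)=R[\mathbf{x}^{\pm1}]\cap R[\mathbf{x}_1^{\pm1}]\cap\dots\cap R[\mathbf{x}_n^{\pm1}]\subseteq\mathcal{F}$. *)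

(* Defs.v *)
From mathcomp Require Import all_boot all_algebra.
From mathcomp Require Import fraction.
From mathcomp.multinomials Require Import mpoly.
From Stdlib Require Import ClassicalEpsilon.

Set Implicit Arguments.
Unset Strict Implicit.
Unset Printing Implicit Defensive.

Import GRing.Theory.
Local Open Scope ring_scope.

Notation "x %:F" := (@FracField.tofrac _ x) : ring_scope.

Definition rdvd (T : comNzRingType) (a b : T) : Prop := exists c : T, b = a * c.

Definition irreducible_elt (T : idomainType) (p : T) : Prop :=
  p != 0 /\ p \isn't a GRing.unit /\
  forall a b : T, p = a * b -> a \is a GRing.unit \/ b \is a GRing.unit.

Definition UFD (R : idomainType) : Prop :=
  (forall a : R, a != 0 -> a \isn't a GRing.unit ->
     exists s : seq R, (forall q, q \in s -> irreducible_elt q) /\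
                       a = \prod_(q <- s) q) /\
  (forall p : R, irreducible_elt p ->
     forall a b : R, rdvd p (a * b) -> rdvd p a \/ rdvd p b).

Definition contains_Z (R : idomainType) : Prop :=
  forall m : nat, (m.+1)%:R != 0 :> R.

Definition Frat (R : idomainType) (n : nat) := {fraction {mpoly R[n]}}.

Definition embK (R : idomainType) (n : nat) (r : R) : Frat R n :=
  (r%:MP : {mpoly R[n]})%:F.

Definition evalK (R : idomainType) (n : nat) (y : 'I_n -> Frat R n)
  (p : {mpoly R[n]}) : Frat R n := mmap (@embK R n) y p.

Definition involves (R : idomainType) (n : nat) (p : {mpoly R[n]}) (i : 'I_n)
  : Prop := exists m : 'X_{1..n}, m \in msupp p /\ (0 < m i)%N.

Definition alg_indep (R : idomainType) (n : nat) (x : 'I_n -> Frat R n)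
  : Prop := forall p : {mpoly R[n]}, evalK x p = 0 -> p = 0.

(** every element of the ambient field is algebraic over Frac(R)(x)
    (equivalently, over R[x], after clearing denominators) *)
Definition algebraic_over (R : idomainType) (n : nat) (x : 'I_n -> Frat R n)
  : Prop := forall y : Frat R n, exists q : {poly {mpoly R[n]}},
    q != 0 /\ (map_poly (evalK x) q).[y] = 0.

Definition transcendence_basis (R : idomainType) (n : nat)
  (x : 'I_n -> Frat R n) : Prop := alg_indep x /\ algebraic_over x.

(** (x, F) is an LP seed; F i is the polynomial F_i, written in the formal
    variables 'X_1..'X_n which stand for x_1..x_n *)
Definition LPseed (R : idomainType) (n : nat) (x : 'I_n -> Frat R n)
  (F : 'I_n -> {mpoly R[n]}) : Prop :=
  transcendence_basis x /\
  (forall i, irreducible_elt (F i)) /\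
  (forall i j : 'I_n, ~ rdvd 'X_j (F i)) /\
  (forall i, ~ involves (F i) i).

(** F_j|_{x_k <- F_k/x'_k}, written in R[x_1,..,x_{k-1},y,x_{k+1},..,x_n]
    where the formal variable 'X_k stands for y = (x'_k)^{-1} *)
Definition Gsub (R : idomainType) (n : nat) (F : 'I_n -> {mpoly R[n]})
  (j k : 'I_n) : {mpoly R[n]} :=
  F j \mPo [tuple (if i == k then F k * 'X_k else 'X_i) | i < n].

Definition hat_exp_spec (R : idomainType) (n : nat) (F : 'I_n -> {mpoly R[n]})
  (j k : 'I_n) (a : nat) : Prop :=
  rdvd (F k ^+ a) (Gsub F j k) /\ ~ rdvd (F k ^+ a.+1) (Gsub F j k).

Definition hat_exp (R : idomainType) (n : nat) (F : 'I_n -> {mpoly R[n]})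
  (j k : 'I_n) : nat := epsilon (inhabits 0%N) (hat_exp_spec F j k).

Definition hatF (R : idomainType) (n : nat) (x : 'I_n -> Frat R n)
  (F : 'I_n -> {mpoly R[n]}) (j : 'I_n) : Frat R n :=
  evalK x (F j) / \prod_(k < n | k != j) x k ^+ hat_exp F j k.

Definition adj_cluster (R : idomainType) (n : nat) (x : 'I_n -> Frat R n)
  (F : 'I_n -> {mpoly R[n]}) (j : 'I_n) : 'I_n -> Frat R n :=
  fun i => if i == j then hatF x F j / x j else x i.

Definition laurent_mem (R : idomainType) (n : nat) (y : 'I_n -> Frat R n)
  (f : Frat R n) : Prop :=
  exists (p : {mpoly R[n]}) (m : 'X_{1..n}),
    f * \prod_(i < n) y i ^+ m i = evalK y p.

Definition upper_bound (R : idomainType) (n : nat) (x : 'I_n -> Frat R n)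
  (F : 'I_n -> {mpoly R[n]}) (f : Frat R n) : Prop :=
  laurent_mem x f /\ forall j : 'I_n, laurent_mem (adj_cluster x F j) f.

Definition XK (R : idomainType) (n : nat) (i : 'I_n) : Frat R n :=
  ('X_i : {mpoly R[n]})%:F.

(** F_k|_{x_i <- 0}  (= \hat F_k|_{x_i <- 0} when \hat F_k = F_k) *)
Definition Pk (R : idomainType) (n : nat) (F : 'I_n -> {mpoly R[n]})
  (k i : 'I_n) : {mpoly R[n]} :=
  F k \mPo [tuple (if l == i then 0 else 'X_l) | l < n].

(** G_i = F_i|_{x_k <- N_k} with N_k = (F_k|_{x_i<-0})/x'_k; the formal
    variable 'X_k now stands for x'_k (and 'X_l for x'_l = x_l, l <> k) *)
Definition Gmut (R : idomainType) (n : nat) (F : 'I_n -> {mpoly R[n]})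
  (k i : 'I_n) : Frat R n :=
  mmap (@embK R n)
    (fun l => if l == k then (Pk F k i)%:F / XK R k else XK R l) (F i).

(** Laurent-polynomial divisibility by q in R[x'_l (l<>k), (x'_k)^{+-1}]
    for q not involving x'_k *)
Definition ldvd_k (R : idomainType) (n : nat) (k : 'I_n) (q : {mpoly R[n]})
  (h : Frat R n) : Prop :=
  exists (d : nat) (Q : {mpoly R[n]}), h * XK R k ^+ d = (q * Q)%:F.

Definition mut_poly (R : idomainType) (n : nat) (F : 'I_n -> {mpoly R[n]})
  (k i : 'I_n) (F'i : {mpoly R[n]}) : Prop :=
  (i = k /\ F'i = F k) \/
  (i <> k /\ ~ involves (F i) k /\
     exists u : R, u \is a GRing.unit /\ F'i = u%:MP * F i) \/
  (i <> k /\ involves (F i) k /\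
     exists (g : {mpoly R[n]}) (ep en : 'X_{1..n}) (u : R),
       u \is a GRing.unit /\
       (* g = product of the common factors removed *)
       g != 0 /\ ~ involves g i /\ ~ involves g k /\
       (exists m : nat, rdvd g (Pk F k i ^+ m)) /\
       (* H_i = G_i / g is a Laurent polynomial *)
       ldvd_k k 1 (Gmut F k i / g%:F) /\
       (* all common factors with \hat F_k|_{x_i<-0} have been removed *)
       (forall q : {mpoly R[n]}, irreducible_elt q -> ~ involves q i ->
          ~ involves q k -> rdvd q (Pk F k i) ->
          ~ ldvd_k k q (Gmut F k i / g%:F)) /\
       (* F'_i = M H_i with M a Laurent monomial in x'_j (j <> i) with
          unit coefficient *)
       ep i = 0%N /\ en i = 0%N /\
       (F'i * 'X_[en])%:F = (u%:MP * 'X_[ep])%:F * (Gmut F k i / g%:F) /\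
       (forall j : 'I_n, ~ rdvd 'X_j F'i)).

(** (x', F') = mu_k(x, F) (up to the choices allowed in the definition) *)
Definition is_mutation (R : idomainType) (n : nat) (x : 'I_n -> Frat R n)
  (F : 'I_n -> {mpoly R[n]}) (k : 'I_n) (x' : 'I_n -> Frat R n)
  (F' : 'I_n -> {mpoly R[n]}) : Prop :=
  (forall i, x' i = (if i == k then hatF x F k / x k else x i)) /\
  (forall i, mut_poly F k i (F' i)).

(* Main.v *)
From HB Require Import structures.
Require Import Defs.
From mathcomp Require Import all_boot all_algebra.
From mathcomp Require Import fraction.
From mathcomp.multinomials Require Import mpoly.
From mathcomp Require Import ring.
From Stdlib Require Import ClassicalEpsilon.

(* Let f = p(x)/x^m be a Laurent polynomial in the cluster x. Then f is a
   Laurent polynomial in the cluster obtained by exchanging x_j for F_j/x_j if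
   and only if p lies in the m_j-th power of the ideal (x_j, F_j) of R[x].
   Since (x_j, F_j) is generated by a regular sequence, membership in its powers
   is unaffected by multiplying p with elements that are regular modulo
   (x_j, F_j); in particular all monomials in the other variables may be cleared.

   Put P = F_k|_{x_j = 0}. Modulo x_j the exchange relation reads x_k x'_k = P,
   so that F_j(x) becomes F_j(P/x'_k), which is F'_j up to a Laurent monomial and
   a divisor of a power of P. The hypothesis on the exchange Laurent polynomials
   makes P regular modulo (x_j, F_j), and the removal of the common factors makes
   it regular modulo (x_j, F'_j). Hence the conditions on f imposed by the j-th
   exchange at x and at x' coincide. In direction k the two seeds just swap the
   clusters x and x', up to monomial factors, which are invertible.

   Regularity modulo (x_j, F) means coprimality after x_j := 0, because R[x] is
   factorial by Gauss's lemma. *)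

Set Implicit Arguments.
Unset Strict Implicit.
Unset Printing Implicit Defensive.

Import GRing.Theory.
Local Open Scope ring_scope.

(** * Factorial domains *)

Definition prime_elt (T : idomainType) (p : T) : Prop :=
  forall a b : T, rdvd p (a * b) -> rdvd p a \/ rdvd p b.

Definition is_length (T : idomainType) (l : T -> nat) : Prop :=
  (forall a b, a != 0 -> b != 0 -> l (a * b) = (l a + l b)%N) /\
  (forall a, a != 0 -> l a = 0%N -> a \is a GRing.unit).

(* An additive length bounds the number of factors; unlike explicit
   factorizations it passes to polynomials at once (add the degree). *)
Definition factorial_domain (T : idomainType) : Prop :=
  (exists l : T -> nat, is_length l) /\
  (forall p : T, irreducible_elt p -> prime_elt p).

Section Factorial.
Variable T : idomainType.
Implicit Types a b p q u : T.

Lemma rdvd_unit p u : u \is a GRing.unit -> rdvd p u -> p \is a GRing.unit.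
Proof. by move=> uU [c E]; move: uU; rewrite E unitrM => /andP[]. Qed.

Lemma rdvd_mulUl p u a : u \is a GRing.unit -> rdvd p (u * a) -> rdvd p a.
Proof.
by move=> uU [c E]; exists (u^-1 * c); rewrite mulrCA -E mulKr.
Qed.

Lemma irreducible_assoc p q :
  p \isn't a GRing.unit -> irreducible_elt q ->
  rdvd p q -> exists2 u, u \is a GRing.unit & q = p * u.
Proof.
move=> pN [_ [_ qI]] [c E]; exists c => //.
by case: (qI _ _ E) => // pU; rewrite pU in pN.
Qed.

Lemma prime_dvd_prod p (s : seq T) : prime_elt p -> p \isn't a GRing.unit ->
  rdvd p (\prod_(q <- s) q) -> exists2 q, q \in s & rdvd p q.
Proof.
move=> pP pN; elim: s => [|q s IHs].
  by rewrite big_nil => /(rdvd_unit (unitr1 T)) pU; rewrite pU in pN.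
rewrite big_cons => /pP[pq|/IHs[r rs pr]].
  by exists q => //; rewrite mem_head.
by exists r => //; rewrite in_cons rs orbT.
Qed.

(** Each prime of [s] divides, hence is associate to, some member of [t]; both are struck out and
    the quotient unit is absorbed into [u]. *)
Lemma factorization_size (s t : seq T) u :
    (forall p, irreducible_elt p -> prime_elt p) ->
    (forall q, q \in s -> irreducible_elt q) ->
    (forall q, q \in t -> irreducible_elt q) ->
    u \is a GRing.unit -> \prod_(q <- s) q = u * \prod_(q <- t) q ->
  size s = size t.
Proof.
move=> irrP; elim: s t u => [|q s IHs] t u sI tI uU.
  case: t tI => // r t tI; rewrite big_nil big_cons => E.
  have [_ [rN _]] := tI r (mem_head _ _).
  case/negP: rN; apply: (@rdvd_unit r 1); first exact: unitr1.
  by exists (u * \prod_(q <- t) q); rewrite mulrCA -E.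
rewrite big_cons => E.
have qI := sI q (mem_head _ _); have [q0 [qN _]] := qI.
have /(prime_dvd_prod (irrP q qI) qN)[r rt qr] : rdvd q (\prod_(r <- t) r).
  by apply: (rdvd_mulUl uU); exists (\prod_(j <- s) j).
have [v vU Er] := irreducible_assoc qN (tI r rt) qr.
rewrite (perm_size (perm_to_rem rt)) /=; congr _.+1.
apply: (IHs _ (u * v)).
- by move=> p ps; apply: sI; rewrite in_cons ps orbT.
- by move=> p /mem_rem; apply: tI.
- by rewrite unitrM uU.
apply: (mulfI q0); rewrite E (perm_big _ (perm_to_rem rt)) big_cons /= Er.
by ring.
Qed.

(** The length of a nonzero element is its number of irreducible factors, which [factorization_size]
    makes independent of the chosen factorization. *)
Lemma UFD_factorial : UFD T -> factorial_domain T.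
Proof.
move=> [facT irrP]; split=> //.
pose P a k := exists u (s : seq T), [/\ u \is a GRing.unit,
  forall q, q \in s -> irreducible_elt q, size s = k & a = u * \prod_(q <- s) q].
pose l a := epsilon (inhabits 0%N) (P a).
have lP a : a != 0 -> P a (l a).
  move=> a0; apply: epsilon_spec.
  have [aU|aN] := boolP (a \is a GRing.unit).
    by exists 0%N, a, [::]; rewrite big_nil mulr1.
  have [s [sI E]] := facT a a0 aN.
  by exists (size s), 1, s; rewrite mul1r unitr1.
exists l; split=> [a b a0 b0|a a0 la0].
  have [u [s [uU sI <- Ea]]] := lP a a0; have [v [t [vU tI <- Eb]]] := lP b b0.
  have [w [r [wU rI <- Eab]]] := lP _ (mulf_neq0 a0 b0).
  rewrite -size_cat; apply/esym/(@factorization_size _ _ ((u * v)^-1 * w)) => //.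
  - by move=> q; rewrite mem_cat => /orP[/sI|/tI].
  - by rewrite unitrM unitrV !unitrM uU vU.
  have uvU : u * v \is a GRing.unit by rewrite unitrM uU.
  rewrite -mulrA -Eab Ea Eb big_cat /= mulrACA mulKr //.
have [u [s [uU _ + Ea]]] := lP a a0.
by rewrite la0 => /size0nil s0; rewrite Ea s0 big_nil mulr1.
Qed.

Lemma length_unit (l : T -> nat) u :
  is_length l -> u \is a GRing.unit -> l u = 0%N.
Proof.
move=> [lM _] uU; have l1 : l 1 = 0%N.
  by apply/(@addnI (l 1)); rewrite -lM ?oner_eq0 // mulr1 addn0.
have u0 : u != 0 by apply: contraTneq uU => ->; rewrite unitr0.
have := lM u u^-1 u0; rewrite invr_eq0 u0 divrr // l1 => /(_ isT)/esym/eqP.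
by rewrite addn_eq0 => /andP[/eqP].
Qed.

Lemma exists_irreducible_dvd a : factorial_domain T -> a != 0 ->
  a \isn't a GRing.unit -> exists2 q, irreducible_elt q & rdvd q a.
Proof.
move=> [[l ll] _]; have [lM lU] := ll.
have [m] := ubnP (l a); elim: m a => // m IHm a lam a0 aN.
have [aI|aI] := classic (irreducible_elt a).
  by exists a => //; exists 1; rewrite mulr1.
have [b [c [E [bN cN]]]] : exists b c, a = b * c /\
    b \isn't a GRing.unit /\ c \isn't a GRing.unit.
  apply: NNPP => H; apply: aI; split=> //; split=> // b c E.
  have [bU|bN] := boolP (b \is a GRing.unit); first by left.
  right; apply/negPn/negP => cN; apply: H; exists b, c.
  by rewrite bN cN.
have /andP[b0 c0] : (b != 0) && (c != 0) by rewrite -negb_or -mulf_eq0 -E.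
have lc : (0 < l c)%N by rewrite lt0n; apply: contraNneq cN => /lU; apply.
have [|q qI [d Ed]] := IHm b _ b0 bN.
  rewrite -ltnS (leq_trans _ lam) // E lM // ltnS -[X in (X < _)%N]addn0.
  by rewrite ltn_add2l.
by exists q => //; exists (d * c); rewrite E Ed mulrA.
Qed.

(** An irreducible factor of [a] is prime and does not divide [b], so it divides [c]; cancelling it
    shortens [a]. *)
Lemma factorial_Gauss_dvd a b c : factorial_domain T -> a != 0 ->
    (forall q, irreducible_elt q -> rdvd q a -> ~ rdvd q b) ->
  rdvd a (b * c) -> rdvd a c.
Proof.
move=> fT; have [[l ll] irrP] := fT; have [lM lU] := ll.
have [m] := ubnP (l a); elim: m a c => // m IHm a c lam a0 cop ac.
have [aU|aN] := boolP (a \is a GRing.unit).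
  by exists (a^-1 * c); rewrite mulVKr.
have [q qI [d E]] := exists_irreducible_dvd fT a0 aN.
have [q0 [qN _]] := qI.
have qa : rdvd q a by exists d.
have [e Ee] := ac.
have /(irrP q qI)[/(cop q qI qa)//|[c' Ec]] : rdvd q (b * c).
  by exists (d * e); rewrite Ee E mulrA.
have d0 : d != 0 by apply: contraNneq a0 => d0; rewrite E d0 mulr0.
have [||||f Ef] := IHm d c'.
- rewrite -ltnS (leq_trans _ lam) // E lM // ltnS -[X in (X < _)%N]add0n.
  by rewrite ltn_add2r lt0n; apply: contraNneq qN => /lU; apply.
- by [].
- by move=> r rI [d' Ed]; apply: cop => //; exists (q * d'); rewrite E Ed; ring.
- by exists e; apply: (mulfI q0); rewrite mulrCA -Ec Ee E mulrA.
by exists f; rewrite Ec Ef E mulrA.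
Qed.

(** The length of [a ^+ m] is at least [m], whereas divisors of [b] are no longer than [b]. This
    bound is what makes the maximal exponents in \hat F_j exist. *)
Lemma factorial_exp_dvd_bounded a b : factorial_domain T ->
    a \isn't a GRing.unit -> b != 0 ->
  exists m, ~ rdvd (a ^+ m) b.
Proof.
move=> [[l ll] _] aN b0; have [lM lU] := ll.
exists (l b).+1 => -[c E].
have a0 : a != 0 by apply: contraNneq b0 => a0; rewrite E a0 expr0n mul0r.
have c0 : c != 0 by apply: contraNneq b0 => c0; rewrite E c0 mulr0.
have la : (0 < l a)%N by rewrite lt0n; apply: contraNneq aN => /lU; apply.
have lX k : l (a ^+ k) = (l a * k)%N.
  elim: k => [|k IHk]; first by rewrite expr0 muln0 (length_unit ll) ?unitr1.
  by rewrite exprS lM ?expf_neq0 // IHk mulnS.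
have := congr1 l E; rewrite lM ?expf_neq0 // lX => E'.
have : (l b < l b)%N; last by rewrite ltnn.
by rewrite [X in (_ < X)%N]E' (leq_trans _ (leq_addr _ _)) // leq_pmull.
Qed.

End Factorial.

Lemma factorial_iso (T S : idomainType) (f : {rmorphism T -> S})
    (g : {rmorphism S -> T}) :
  cancel f g -> cancel g f -> factorial_domain S -> factorial_domain T.
Proof.
move=> fK gK [[l [lM lU]] irrP].
have f0 a : a != 0 -> f a != 0 by rewrite -(inj_eq (can_inj fK)) rmorph0.
have fU a : f a \is a GRing.unit -> a \is a GRing.unit.
  by move=> faU; rewrite -(fK a) rmorph_unit.
split.
  exists (l \o f); split=> [a b a0 b0|a a0 /= la]; first by rewrite /= rmorphM lM ?f0.
  by apply: fU; apply: lU => //; apply: f0.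
move=> p [p0 [pN pI]] a b [c E].
have fdvd d : rdvd (f p) (f d) -> rdvd p d.
  by move=> [e Ee]; exists (g e); rewrite -(fK d) Ee rmorphM fK.
have /irrP/(_ (f a) (f b)) : irreducible_elt (f p).
  split; first exact: f0.
  split=> [|u v Euv]; first by apply: contra pN => /fU.
  have /pI[gU|gU] : p = g u * g v by rewrite -rmorphM -Euv fK.
    by left; rewrite -(gK u) rmorph_unit.
  by right; rewrite -(gK v) rmorph_unit.
case=> [|/fdvd|/fdvd]; [|by left|by right].
by exists (f c); rewrite -!rmorphM E.
Qed.

(** * Gauss's lemma *)

Section Gauss.
Variable T : idomainType.
Implicit Types (c q : T) (a b p d : {poly T}).

Lemma polyC_unit c : (c%:P \is a GRing.unit) = (c \is a GRing.unit).
Proof.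
rewrite poly_unitE coefC size_polyC eqxx; have [->|] := eqVneq c 0 => //=.
by rewrite unitr0.
Qed.

(** If [q] divides [a * b] it divides one of the two leading coefficients; dropping that leading
    term keeps the product divisible by [q] and lowers the total size. *)
Lemma polyC_prime q : prime_elt q -> prime_elt q%:P.
Proof.
move=> qP; have lead_split a : rdvd q (lead_coef a) -> exists a1 a2,
    [/\ a = q%:P * a1 + a2 & (size a2 <= (size a).-1)%N].
  move=> [c Ec]; exists (c%:P * 'X^((size a).-1)), (take_poly (size a).-1 a).
  split; last exact: size_take_poly.
  rewrite -{1}(poly_take_drop (size a).-1 a) addrC mulrA -polyCM -Ec.
  congr (_ * _ + _); rewrite [LHS]size1_polyC; last first.
    by rewrite size_drop_poly; case: (size a) => // m; rewrite subSnn.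
  by rewrite coef_drop_poly lead_coefE add0n.
move=> a b; have [m] := ubnP (size a + size b).
elim: m a b => // m IHm a b; rewrite ltnS => sab [c Ec].
have [->|a0] := eqVneq a 0; first by left; exists 0; rewrite mulr0.
have [->|b0] := eqVneq b 0; first by right; exists 0; rewrite mulr0.
have spos p : p != 0 -> (0 < size p)%N by rewrite lt0n size_poly_eq0.
have : rdvd q (lead_coef a * lead_coef b).
  by exists (lead_coef c); rewrite -lead_coefM Ec lead_coefM lead_coefC.
case/qP => /lead_split[p1 [p2 [Ep sp]]].
- have [||[e Ee]|] := IHm p2 b; last by right.
  + rewrite (leq_trans _ sab) // ltn_add2r (leq_ltn_trans sp) // prednK //.
    exact: spos.
  + exists (c - p1 * b); rewrite mulrBr -Ec Ep; ring.
  by left; exists (p1 + e); rewrite Ep Ee mulrDr.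
- have [|||[e Ee]] := IHm a p2; first 1 last.
  + exists (c - a * p1); rewrite mulrBr -Ec Ep; ring.
  + by left.
  + by right; exists (p1 + e); rewrite Ep Ee mulrDr.
  rewrite (leq_trans _ sab) // ltn_add2l (leq_ltn_trans sp) // prednK //.
  exact: spos.
Qed.

(** The irreducible factors of [c] stay prime as constant polynomials, so they can be handed one by
    one to [a] or to [b]. This takes the place of contents and primitive parts. *)
Lemma polyC_mul_split c p a b : factorial_domain T -> c != 0 -> c%:P * p = a * b ->
  exists ca cb a' b', [/\ ca != 0, cb != 0, a = ca%:P * a', b = cb%:P * b'
                        & p = a' * b'].
Proof.
move=> fT; have [[l ll] irrP] := fT; have [lM lU] := ll.
have [m] := ubnP (l c); elim: m c p a b => // m IHm c p a b lcm c0 E.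
have [cU|cN] := boolP (c \is a GRing.unit).
  exists c, 1, (c^-1%:P * a), b; rewrite oner_eq0 mul1r mulrA -polyCM divrr //.
  by rewrite mul1r -mulrA -E mulrA -polyCM mulVr // mul1r.
have [q qI [c' Ec]] := exists_irreducible_dvd fT c0 cN.
have [q0 [qN _]] := qI.
have c'0 : c' != 0 by apply: contraNneq c0 => e; rewrite Ec e mulr0.
have lc' : (l c' < m)%N.
  rewrite -ltnS (leq_trans _ lcm) // Ec lM // ltnS -[X in (X < _)%N]add0n.
  by rewrite ltn_add2r lt0n; apply: contraNneq qN => /lU; apply.
have qP0 : q%:P != 0 :> {poly T} by rewrite polyC_eq0.
have : rdvd q%:P (a * b).
  by exists (c'%:P * p); rewrite -E Ec polyCM mulrA.
case/(polyC_prime (irrP q qI)) => -[d Ed].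
  have [|ca [cb [a' [b' [ca0 cb0 Ea Eb Ep]]]]] := IHm c' p d b lc' c'0.
    by apply: (mulfI qP0); rewrite mulrA -polyCM -Ec E Ed mulrA.
  exists (q * ca), cb, a', b'; split=> //; first by rewrite mulf_neq0.
  by rewrite Ed Ea polyCM mulrA.
have [|ca [cb [a' [b' [ca0 cb0 Ea Eb Ep]]]]] := IHm c' p a d lc' c'0.
  by apply: (mulfI qP0); rewrite mulrA -polyCM -Ec E Ed mulrCA.
exists ca, (q * cb), a', b'; split=> //; first by rewrite mulf_neq0.
by rewrite Ed Eb polyCM mulrA.
Qed.

(** Here [%|] is divisibility up to a nonzero constant, that is, over the fraction field. The share
    of that constant falling to [p] is a unit, because [p] is irreducible of positive degree. *)
Lemma poly_irreducible_dvd p a : factorial_domain T -> irreducible_elt p ->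
  (1 < size p)%N -> p %| a -> rdvd p a.
Proof.
move=> fT pI sp /Pdiv.WeakIdomain.dvdpP[[c k] /= c0 E].
have [|cp [ck [p' [k' [cp0 ck0 Ep Ek Ea]]]]] := @polyC_mul_split c a p k fT c0.
  by rewrite mul_polyC E mulrC.
have [_ [_ /(_ _ _ Ep)[cU|pU]]] := pI; last first.
  move: sp; rewrite Ep size_Cmul //; move: pU; rewrite poly_unitE => /andP[].
  by move=> /eqP ->.
by exists (cp%:P^-1 * k'); rewrite Ep Ea mulrCA !mulrA mulVr // mul1r mulrC.
Qed.

Lemma poly_factorial : factorial_domain T -> factorial_domain {poly T}.
Proof.
move=> fT; have [[l [lM lU]] irrP] := fT; split.
  (* Degree plus length of the leading coefficient; it vanishes only on constants of length zero,
     which are units. *)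
  exists (fun p => (size p).-1 + l (lead_coef p))%N; split=> [a b a0 b0|a a0].
    rewrite lead_coefM lM ?lead_coef_eq0 // size_mul // addnACA; congr (_ + _)%N.
    rewrite -size_poly_gt0 in a0; rewrite -size_poly_gt0 in b0.
    by case: (size a) a0 (size b) b0 => // i _ [|j] // _; rewrite !addnS.
  move/eqP; rewrite addn_eq0 => /andP[/eqP sa /eqP la].
  have Ea : a = (a`_0)%:P.
    by apply: size1_polyC; case: (size a) sa => // -[].
  rewrite Ea polyC_unit; apply: lU; first by rewrite -polyC_eq0 -Ea.
  by move: la; rewrite {1}Ea lead_coefC.
move=> p pI; have [p0 [pN pM]] := pI; have [sp|sp] := leqP (size p) 1%N.
  rewrite (size1_polyC sp) in p0 pN pM *; apply: polyC_prime; apply: irrP.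
  split; first by rewrite -polyC_eq0.
  split=> [|a b Eab]; first by rewrite -polyC_unit.
  by have := pM a%:P b%:P; rewrite !polyC_unit; apply; rewrite -polyCM Eab.
move=> a b [k Ek].
have pab : p %| a * b by rewrite Ek dvdp_mulIl.
have [cop|ncop] := boolP (coprimep p a).
  by right; apply: poly_irreducible_dvd => //; rewrite -(Gauss_dvdpr b cop).
left; apply: poly_irreducible_dvd => //.
(* The gcd is a nonconstant divisor of [p] up to constants. Irreducibility makes the cofactor [e'] a
   unit, so [p] is itself the gcd up to constants and divides [a]. *)
have /Pdiv.WeakIdomain.dvdpP[[c e] /= c0 E] := dvdp_gcdl p a.
have [|ce [cg [e' [g' [ce0 cg0 _ Eg Ep]]]]] := @polyC_mul_split c p e (gcdp p a) fT c0.
  by rewrite mul_polyC E.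
have [eU|gU] := pM _ _ Ep; last first.
  case/negP: ncop; rewrite coprimep_def Eg size_Cmul //.
  by move: gU; rewrite poly_unitE => /andP[].
apply: dvdp_trans (dvdp_gcdr p a).
rewrite Eg mul_polyC dvdpZr // Ep -[X in _ %| X](mulKr eU).
by rewrite dvdp_mulIr.
Qed.

End Gauss.

(** * Factoriality of polynomial rings in [n] variables, by adjoining one variable at a time *)

Section MpolyFactorial.
Variable R : idomainType.

(** The inverse of [muni], which singles out the last variable. *)
Definition mpoly_of_uni (n : nat) (q : {poly {mpoly R[n]}}) : {mpoly R[n.+1]} :=
  (map_poly (@mwiden n R) q).['X_ord_max].

Lemma mpoly_of_uniB n : zmod_morphism (@mpoly_of_uni n).
Proof. by move=> p q; rewrite /mpoly_of_uni rmorphB hornerD hornerN. Qed.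

Lemma mpoly_of_uniD n : {morph @mpoly_of_uni n : p q / p + q}.
Proof. by move=> p q; rewrite /mpoly_of_uni rmorphD hornerD. Qed.

Lemma mpoly_of_uniM n : {morph @mpoly_of_uni n : p q / p * q}.
Proof. by move=> p q; rewrite /mpoly_of_uni rmorphM hornerM. Qed.

Lemma mpoly_of_uni_monoid_morphism n : monoid_morphism (@mpoly_of_uni n).
Proof.
by split; [rewrite /mpoly_of_uni rmorph1 hornerC | exact: mpoly_of_uniM].
Qed.

HB.instance Definition _ n := GRing.isZmodMorphism.Build
  {poly {mpoly R[n]}} {mpoly R[n.+1]} (@mpoly_of_uni n) (@mpoly_of_uniB n).
HB.instance Definition _ n := GRing.isMonoidMorphism.Build
  {poly {mpoly R[n]}} {mpoly R[n.+1]} (@mpoly_of_uni n)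
  (@mpoly_of_uni_monoid_morphism n).

(** Induction over ring generators, suited to comparing substitutions: these are determined by
    constants and variables. *)
Lemma mpoly_alg_ind n (P : {mpoly R[n]} -> Prop) :
    (forall c, P c%:MP) -> (forall i, P 'X_i) ->
    (forall p q, P p -> P q -> P (p + q)) ->
    (forall p q, P p -> P q -> P (p * q)) ->
  forall p, P p.
Proof.
move=> PC PX PD PM; elim/mpolyind => [|c m p _ _ Pp]; first by rewrite -mpolyC0.
apply: (PD _ _ _ Pp); rewrite -mul_mpolyC mpolyXE_id; apply: (PM _ _ (PC c)).
apply: big_ind => [|//|i _]; first by rewrite -mpolyC1.
by elim: (m i) => [|k IHk]; rewrite ?expr0 -?mpolyC1 // exprS; apply: PM.
Qed.

Lemma mpoly_of_uniC n (c : {mpoly R[n]}) : mpoly_of_uni c%:P = mwiden c.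
Proof. by rewrite /mpoly_of_uni map_polyC hornerC. Qed.

Lemma mpoly_of_uniX n : mpoly_of_uni 'X = 'X_ord_max :> {mpoly R[n.+1]}.
Proof. by rewrite /mpoly_of_uni map_polyX hornerX. Qed.

Lemma muniX_max n : muni ('X_ord_max : {mpoly R[n.+1]}) = 'X.
Proof.
rewrite /muni mmapX mmap1U; case: splitP => [j /= E|//].
by have := ltn_ord j; rewrite -E ltnn.
Qed.

Lemma muniX_widen n i : muni ('X_(widen_ord (leqnSn n) i) : {mpoly R[n.+1]}) = ('X_i)%:P.
Proof.
rewrite /muni mmapX mmap1U; case: splitP => [j /= E|j /= E].
  by congr ('X_ _)%:P; apply/val_inj.
by have := ltn_ord i; rewrite E -[X in (_ < X)%N]addn0 ltn_add2l ltn0.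
Qed.

Lemma mwidenXi n (i : 'I_n) :
  mwiden ('X_i : {mpoly R[n]}) = 'X_(widen_ord (leqnSn n) i).
Proof. by rewrite mwidenX mnmwiden1. Qed.

Lemma muniK n : cancel (@muni n R) (@mpoly_of_uni n).
Proof.
elim/mpoly_alg_ind => [c|i|p q Ep Eq|p q Ep Eq].
- by rewrite muniC mpoly_of_uniC mwidenC.
- have [j ->|->] := unliftP ord_max i.
    have -> : lift ord_max j = widen_ord (leqnSn n) j.
      by apply/val_inj; rewrite /= /bump leqNgt ltn_ord.
    by rewrite muniX_widen mpoly_of_uniC mwidenXi.
  by rewrite muniX_max mpoly_of_uniX.
- by rewrite muniD mpoly_of_uniD; congr (_ + _).
- by rewrite muniM mpoly_of_uniM; congr (_ * _).
Qed.

Lemma mpoly_of_uniK n : cancel (@mpoly_of_uni n) (@muni n R).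
Proof.
elim/poly_ind => [|p c IHp]; first by rewrite !rmorph0.
rewrite mpoly_of_uniD mpoly_of_uniM mpoly_of_uniX muniD muniM muniX_max IHp mpoly_of_uniC.
congr (_ + _).
elim/mpoly_alg_ind: c => [c|i|c d Ec Ed|c d Ec Ed].
- by rewrite mwidenC muniC.
- by rewrite mwidenXi muniX_widen.
- by rewrite mwidenD muniD Ec Ed polyCD.
- by rewrite mwidenM muniM Ec Ed polyCM.
Qed.

Lemma mpoly0_factorial : factorial_domain R -> factorial_domain {mpoly R[0]}.
Proof.
pose f := meval (fun _ : 'I_0 => 0 : R).
have fK : cancel f (@mpolyC 0 R).
  elim/mpoly_alg_ind => [c|[]//|p q Ep Eq|p q Ep Eq].
  - by rewrite /f mevalC.
  - by rewrite /f mevalD mpolyCD Ep Eq.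
  - by rewrite /f mevalM mpolyCM Ep Eq.
apply: (@factorial_iso _ _ f (@mpolyC 0 R) fK) => c; exact: mevalC.
Qed.

Lemma mpoly_factorial n : factorial_domain R -> factorial_domain {mpoly R[n]}.
Proof.
move=> fR; elim: n => [|n IHn]; first exact: mpoly0_factorial.
exact: (@factorial_iso _ _ (@muni n R) (@mpoly_of_uni n) (@muniK n)
  (@mpoly_of_uniK n) (poly_factorial IHn)).
Qed.

End MpolyFactorial.

(** * Powers of an ideal generated by a regular sequence *)

Definition ideal2 (T : idomainType) (x F a : T) : Prop :=
  exists b c, a = x * b + F * c.

Definition reg_mod (T : idomainType) (x F u : T) : Prop :=
  forall y, ideal2 x F (u * y) -> ideal2 x F y.

(* The [N]-th power of the ideal [(x, F)]. *)
Fixpoint ipow (T : idomainType) (x F : T) (N : nat) (a : T) : Prop :=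
  if N is N'.+1 then exists e a', a = F ^+ N * e + x * a' /\ ipow x F N' a'
  else True.

Section IdealPowers.
Variables (T : idomainType) (x F : T).
Implicit Types a b c e u : T.
Local Notation J := (ipow x F).

Lemma ipowD N a b : J N a -> J N b -> J N (a + b).
Proof.
elim: N a b => //= N IHN _ _ [e [a [-> Ja]]] [f [b [-> Jb]]].
by exists (e + f), (a + b); split; [ring | apply: IHN].
Qed.

Lemma ipowMr N c a : J N a -> J N (c * a).
Proof.
elim: N a => //= N IHN _ [e [a [-> Ja]]].
by exists (c * e), (c * a); split; [ring | apply: IHN].
Qed.

Lemma ipow_mulx N a : J N a -> J N.+1 (x * a).
Proof. by move=> Ja; exists 0, a; rewrite mulr0 add0r. Qed.

Lemma ipow_mulF N a : J N a -> J N.+1 (F * a).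
Proof.
elim: N a => [|N IHN] a; first by exists a, 0; rewrite mulr0 addr0 expr1.
by move=> [e [b [-> /IHN Jb]]]; exists e, (F * b); split=> //; rewrite !exprS; ring.
Qed.

Lemma ipow_mulXF N m a : J N a -> J (m + N) (F ^+ m * a).
Proof.
by move=> Ja; elim: m => [|m IHm]; rewrite ?mul1r // exprS -mulrA; apply: ipow_mulF.
Qed.

Lemma ipow_mulXx N m a : J N a -> J (m + N) (x ^+ m * a).
Proof.
by move=> Ja; elim: m => [|m IHm]; rewrite ?mul1r // exprS -mulrA; apply: ipow_mulx.
Qed.

Lemma ipow_expF m a : J m (F ^+ m * a).
Proof. by rewrite -{1}[m]addn0; apply: ipow_mulXF. Qed.

Lemma ipow_expx m a : J m (x ^+ m * a).
Proof. by rewrite -{1}[m]addn0; apply: ipow_mulXx. Qed.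

Lemma ipowM N M a b : J N a -> J M b -> J (N + M) (a * b).
Proof.
elim: N a => [|N IHN] a; first by move=> _; apply: ipowMr.
move=> [e [c [-> Jc]]] Jb; rewrite mulrDl; apply: ipowD.
  by rewrite -mulrA; apply: ipow_mulXF; apply: ipowMr.
by rewrite -mulrA; apply: ipow_mulx; apply: IHN.
Qed.

Lemma ideal2_ipow a : ideal2 x F a -> J 1 a.
Proof. by move=> [b [c ->]]; exists c, b; rewrite addrC expr1. Qed.

Lemma reg_mod1 : reg_mod x F 1.
Proof. by move=> y; rewrite mul1r. Qed.

Lemma reg_modM u v : reg_mod x F u -> reg_mod x F v -> reg_mod x F (u * v).
Proof. by move=> uR vR y; rewrite -mulrA => /uR/vR. Qed.

Lemma reg_modX u m : reg_mod x F u -> reg_mod x F (u ^+ m).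
Proof.
move=> uR; elim: m => [|m IHm]; first exact: reg_mod1.
by rewrite exprS; apply: reg_modM.
Qed.

Lemma reg_mod_dvd u v : rdvd u v -> reg_mod x F v -> reg_mod x F u.
Proof.
move=> [w ->] vR y [b [c E]]; apply: vR; exists (w * b), (w * c).
by rewrite mulrAC E; ring.
Qed.

Lemma reg_mod_congr u v w : u = v + x * w -> reg_mod x F v -> reg_mod x F u.
Proof.
move=> -> vR y [b [c E]]; apply: vR; exists (b - w * y), c.
by rewrite mulrBr -addrAC -E; ring.
Qed.

Hypothesis x0 : x != 0.
Hypothesis Fx : forall y, rdvd x (F * y) -> rdvd x y.

Lemma exp_regx m y : rdvd x (F ^+ m * y) -> rdvd x y.
Proof. by elim: m y => [|m IHm] y; rewrite ?mul1r // exprS -mulrA => /Fx/IHm. Qed.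

(** If [x * a = F^(N+1) * e + x * b], then [x] divides [F^(N+1) * e], hence [e], and can be
    cancelled throughout. *)
Lemma ipow_cancelx N a : J N.+1 (x * a) -> J N a.
Proof.
move=> [e [b [E Jb]]].
have /exp_regx[f Ef] : rdvd x (F ^+ N.+1 * e).
  by exists (a - b); rewrite mulrBr E; ring.
have -> : a = F ^+ N * (F * f) + b.
  by apply: (mulfI x0); rewrite E Ef exprS; ring.
by apply: ipowD => //; apply: ipow_expF.
Qed.

(** From [F * a = F^(N+2) * e + x * b], regularity of [F] modulo [x] gives [a = F^(N+1) * e + x * f]
    with [F * f = b], and the induction applies to [f]. *)
Lemma ipow_cancelF N a : J N.+1 (F * a) -> J N a.
Proof.
elim: N a => // N IHN a [e [b [E Jb]]].
have /Fx[f Ef] : rdvd x (F * (a - F ^+ N.+1 * e)).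
  by exists b; rewrite mulrBr E (exprS F N.+1); ring.
exists e, f; split; first by rewrite -Ef; ring.
apply: IHN; suff -> : F * f = b by [].
apply: (mulfI x0); rewrite mulrCA -Ef mulrBr E (exprS F N.+1); ring.
Qed.

Lemma ipow_cancelXx m N a : J (m + N) (x ^+ m * a) -> J N a.
Proof.
by elim: m => [|m IHm]; rewrite ?mul1r // exprS -mulrA => /ipow_cancelx/IHm.
Qed.

Lemma ipow_cancelXF m N a : J (m + N) (F ^+ m * a) -> J N a.
Proof.
by elim: m => [|m IHm]; rewrite ?mul1r // exprS -mulrA => /ipow_cancelF/IHm.
Qed.

(** Regularity passes from [(x, F)] to [(x, F^m)]: writing [y = x * b' + F^m * c'] and cancelling
    [F^m] modulo [x] puts [u * c'], hence [c'], into [(x, F)]. *)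
Lemma reg_mod_exp u m y : reg_mod x F u ->
  ideal2 x (F ^+ m) (u * y) -> ideal2 x (F ^+ m) y.
Proof.
move=> uR; elim: m y => [|m IHm] y [b [c E]].
  by exists 0, y; rewrite mulr0 add0r mul1r.
have [|b' [c' E']] := IHm y.
  by exists b, (F * c); rewrite E exprS; ring.
have /exp_regx[d Ed] : rdvd x (F ^+ m * (u * c' - F * c)).
  exists (b - u * b'); rewrite mulrBr mulrBr [x * (u * b')]mulrCA.
  have -> : x * b' = y - F ^+ m * c' by rewrite E'; ring.
  rewrite mulrBr E exprS; ring.
have [|b1 [c1 E1]] := uR c'; first by exists d, c; rewrite -Ed; ring.
by exists (b' + F ^+ m * b1), c1; rewrite E' E1 exprS; ring.
Qed.

(* [F] is regular modulo [x], so the associated graded ring of [(x, F)] is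
   polynomial over the quotient by [(x, F)]. *)
Lemma ipow_cancel_reg u N a : reg_mod x F u -> J N (u * a) -> J N a.
Proof.
move=> uR; elim: N a => // N IHN a [e [c [E Jc]]].
have [|b [f Ea]] := @reg_mod_exp u N.+1 a uR.
  by exists c, e; rewrite E addrC.
exists f, b; split; first by rewrite addrC.
have /exp_regx[w Ew] : rdvd x (F ^+ N.+1 * (e - u * f)).
  by exists (u * b - c); rewrite mulrBr mulrBr [x * (u * b)]mulrCA;
    have -> : x * b = a - F ^+ N.+1 * f; [rewrite Ea; ring | rewrite mulrBr E; ring].
(* Comparing the two expressions of [u * a] and dividing by [x], [u * b] and [c] differ by a
   multiple of [F^(N+1)]. *)
apply: IHN; have -> : u * b = F ^+ N * (F * w) + c.
  apply: (mulfI x0); have -> : x * (F ^+ N * (F * w) + c) =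
    F ^+ N.+1 * (x * w) + x * c by rewrite exprS; ring.
  have -> : x * (u * b) = u * a - F ^+ N.+1 * (u * f) by rewrite Ea; ring.
  rewrite E -Ew; ring.
by apply: ipowD => //; apply: ipow_expF.
Qed.

End IdealPowers.

(** * Evaluation and substitution *)

Section Eval.
Variables (R : idomainType) (n : nat).
Local Notation A := {mpoly R[n]}.
Local Notation K := (Frat R n).
Implicit Types (p q a b : A) (y : 'I_n -> K) (i j k l : 'I_n) (m : 'X_{1..n}).

Lemma embK_zmod_morphism : zmod_morphism (@embK R n).
Proof. by move=> r s; rewrite /embK mpolyCB rmorphB. Qed.

Lemma embK_monoid_morphism : monoid_morphism (@embK R n).
Proof. by split=> [|r s]; rewrite /embK ?mpolyC1 ?rmorph1 // mpolyCM rmorphM. Qed.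

HB.instance Definition _ :=
  GRing.isZmodMorphism.Build R K (@embK R n) embK_zmod_morphism.
HB.instance Definition _ :=
  GRing.isMonoidMorphism.Build R K (@embK R n) embK_monoid_morphism.
HB.instance Definition _ y := GRing.RMorphism.copy (evalK y) (mmap (@embK R n) y).

Lemma evalKC y c : evalK y c%:MP = embK n c.
Proof. exact: mmapC. Qed.

Lemma evalKXi y i : evalK y 'X_i = y i.
Proof. by rewrite /evalK mmapX mmap1U. Qed.

Lemma evalKXm y m : evalK y 'X_[m] = \prod_(i < n) y i ^+ m i.
Proof. by rewrite /evalK mmapX. Qed.

Lemma eq_evalK y1 y2 : y1 =1 y2 -> evalK y1 =1 evalK y2.
Proof.
by move=> E p; apply: eq_bigr => m _; congr (_ * _); apply: eq_bigr => i _; rewrite E.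
Qed.

Lemma evalK_XK p : evalK (@XK R n) p = p%:F.
Proof.
elim/mpoly_alg_ind: p => [c|i|p q Ep Eq|p q Ep Eq].
- by rewrite evalKC.
- by rewrite evalKXi.
- by rewrite !rmorphD /= Ep Eq.
- by rewrite !rmorphM /= Ep Eq.
Qed.

Lemma evalK_notinvolves y1 y2 p i : ~ involves p i ->
  (forall l, l != i -> y1 l = y2 l) -> evalK y1 p = evalK y2 p.
Proof.
move=> pi E; rewrite /evalK /mmap !big_seq; apply: eq_bigr => m mp.
congr (_ * _); apply: eq_bigr => l _; have [->|/E->//] := eqVneq l i.
have -> : m i = 0%N.
  by apply/eqP; rewrite -leqn0 leqNgt; apply/negP => mi; apply: pi; exists m.
by rewrite !expr0.
Qed.

Definition setc (S : Type) k (t : S) (f : 'I_n -> S) : 'I_n -> S :=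
  fun l => if l == k then t else f l.

(** [Pk F k i] is convertible to [zero_var i (F k)]. *)
Definition zero_var i p : A := p \mPo [tuple (if l == i then 0 else 'X_l) | l < n].

HB.instance Definition _ i := GRing.RMorphism.copy (zero_var i)
  (comp_mpoly [tuple (if l == i then 0 else 'X_l : A) | l < n]).

Lemma zero_varC i c : zero_var i c%:MP = c%:MP.
Proof. exact: comp_mpolyC. Qed.

Lemma zero_varXi i l : zero_var i 'X_l = if l == i then 0 else 'X_l.
Proof. by rewrite /zero_var comp_mpolyXU -tnth_nth tnth_mktuple. Qed.

Lemma evalK_zero_var y i p : evalK y (zero_var i p) = evalK (setc i 0 y) p.
Proof.
elim/mpoly_alg_ind: p => [c|l|p q Ep Eq|p q Ep Eq].
- by rewrite zero_varC !evalKC.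
- by rewrite zero_varXi evalKXi /setc; case: eqP => _; rewrite ?raddf0 ?evalKXi.
- by rewrite !rmorphD /= Ep Eq.
- by rewrite !rmorphM /= Ep Eq.
Qed.

Lemma tofrac_inj p q : p%:F = q%:F -> p = q.
Proof. by move/eqP; rewrite tofrac_eq => /eqP. Qed.

Lemma zero_var_notinvolves i p : ~ involves p i -> zero_var i p = p.
Proof.
move=> pi; apply: tofrac_inj; rewrite -!evalK_XK evalK_zero_var.
by apply: (evalK_notinvolves pi) => l /negbTE li; rewrite /setc li.
Qed.

Lemma zero_var_mod i p : exists w, p = zero_var i p + 'X_i * w.
Proof.
elim/mpoly_alg_ind: p => [c|l|p q [v Ep] [w Eq]|p q [v Ep] [w Eq]].
- by exists 0; rewrite zero_varC mulr0 addr0.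
- rewrite zero_varXi; case: eqP => [->|_]; first by exists 1; rewrite add0r mulr1.
  by exists 0; rewrite mulr0 addr0.
- by exists (v + w); rewrite {1}Ep {1}Eq rmorphD /=; ring.
- exists (v * zero_var i q + zero_var i p * w + 'X_i * v * w).
  by rewrite {1}Ep {1}Eq rmorphM /=; ring.
Qed.

Lemma zero_var_id i p : zero_var i (zero_var i p) = zero_var i p.
Proof.
apply: tofrac_inj; rewrite -!evalK_XK !evalK_zero_var; apply: eq_evalK => l.
by rewrite /setc; case: (l == i).
Qed.

Lemma rdvdX i p : rdvd 'X_i p <-> zero_var i p = 0.
Proof.
split=> [[q ->]|E]; first by rewrite rmorphM /= zero_varXi eqxx mul0r.
by have [w ->] := zero_var_mod i p; exists w; rewrite E add0r.
Qed.

Lemma mpolyX_neq0 m : 'X_[m] != 0 :> A.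
Proof. by rewrite -msize_poly_eq0 msizeX. Qed.

Lemma zero_varXm i m : m i = 0%N -> zero_var i 'X_[m] = 'X_[m].
Proof.
move=> mi; rewrite mpolyXE_id rmorph_prod; apply: eq_bigr => l _.
rewrite rmorphXn /= zero_varXi; case: eqP => [->|//]; by rewrite mi !expr0.
Qed.

(** What is needed of an exchange polynomial in direction [j]: [X_j, F] is then a regular sequence,
    and the other variables are regular modulo it. *)
Definition admissible j (F : A) := zero_var j F = F /\ forall l, ~ rdvd 'X_l F.

Lemma admissible_neq0 j F : admissible j F -> F != 0.
Proof.
by move=> [_ FX]; apply/eqP => F0; apply: (FX j); exists 0; rewrite F0 mulr0.
Qed.

Lemma admissible_regx j F (y : A) : admissible j F -> rdvd 'X_j (F * y) -> rdvd 'X_j y.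
Proof.
move=> Fg /rdvdX; rewrite rmorphM /= Fg.1 => /eqP.
by rewrite mulf_eq0 (negbTE (admissible_neq0 Fg)) => /eqP/rdvdX.
Qed.

Lemma rdvdX_mul i a b : rdvd 'X_i (a * b) -> rdvd 'X_i a \/ rdvd 'X_i b.
Proof.
move=> /rdvdX; rewrite rmorphM => /eqP; rewrite mulf_eq0.
by case/orP => /eqP/rdvdX; [left|right].
Qed.

(** As [F] is free of [X_j], setting [X_j] to 0 turns membership in [(X_j, F)] into divisibility by
    [F]. *)
Lemma reg_mod_coprime j F u : admissible j F ->
    (forall a b, zero_var j u * a = F * b -> rdvd F a) -> reg_mod 'X_j F u.
Proof.
move=> Fg cop y [b [c E]].
have [|d Ed] := cop (zero_var j y) (zero_var j c).
  by rewrite -rmorphM E rmorphD !rmorphM /= zero_varXi eqxx mul0r add0r Fg.1.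
by have [w ->] := zero_var_mod j y; exists w, d; rewrite Ed addrC.
Qed.

Lemma reg_mod_Xi j F l : admissible j F -> l != j -> reg_mod 'X_j F 'X_l.
Proof.
move=> Fg lj; apply: reg_mod_coprime => // a b.
rewrite zero_varXi (negbTE lj) => E.
have [|/(Fg.2 l)//|[c Ec]] := @rdvdX_mul l F b; first by exists a; rewrite -E.
exists c; apply: (mulfI (mpolyX_neq0 U_(l))).
by rewrite E Ec mulrCA.
Qed.

Lemma reg_mod_Xm j F m : admissible j F -> m j = 0%N -> reg_mod 'X_j F 'X_[m].
Proof.
move=> Fg mj; rewrite ['X_[m]]mpolyXE_id; elim: (index_enum _) => [|l s IHs].
  by rewrite big_nil; exact: reg_mod1.
rewrite big_cons; apply: reg_modM IHs; have [->|lj] := eqVneq l j.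
  by rewrite mj expr0; exact: reg_mod1.
by apply: reg_modX; apply: reg_mod_Xi.
Qed.

(* Common denominators for the values of [F] at [X_k := a1 / b] and
   [X_k := a2 / b]. *)
Lemma subst_fraction k a1 a2 b p : exists (d : nat) (q1 q2 e : A),
  q1 = q2 + (a1 - a2) * e /\ (forall y t,
   (evalK y b * t = evalK y a1 ->
      evalK y q1 = evalK y b ^+ d * evalK (setc k t y) p) /\
   (evalK y b * t = evalK y a2 ->
      evalK y q2 = evalK y b ^+ d * evalK (setc k t y) p)).
Proof.
elim/mpoly_alg_ind: p => [c|l||].
- exists 0%N, c%:MP, c%:MP, 0; split; first by rewrite mulr0 addr0.
  by move=> y t; rewrite !evalKC expr0 mul1r.
- have [->|/negbTE lk] := eqVneq l k.
    exists 1%N, a1, a2, 1; split; first by ring.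
    by move=> y t; rewrite evalKXi /setc eqxx expr1; split=> ->.
  exists 0%N, 'X_l, 'X_l, 0; split; first by rewrite mulr0 addr0.
  by move=> y t; rewrite !evalKXi /setc lk expr0 mul1r.
- move=> p p' [d [q1 [q2 [e [E H]]]]] [d' [q1' [q2' [e' [E' H']]]]].
  exists (d + d')%N, (b ^+ d' * q1 + b ^+ d * q1'), (b ^+ d' * q2 + b ^+ d * q2').
  exists (b ^+ d' * e + b ^+ d * e'); split; first by rewrite E E'; ring.
  move=> y t; have [H1 H2] := H y t; have [H1' H2'] := H' y t.
  split=> Et; rewrite !rmorphD !rmorphM /= !rmorphXn /= exprD.
    by rewrite H1 // H1' //; ring.
  by rewrite H2 // H2' //; ring.
move=> p p' [d [q1 [q2 [e [E H]]]]] [d' [q1' [q2' [e' [E' H']]]]].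
exists (d + d')%N, (q1 * q1'), (q2 * q2'), (e * q1' + q2 * e'); split.
  by rewrite E E'; ring.
move=> y t; have [H1 H2] := H y t; have [H1' H2'] := H' y t.
split=> Et; rewrite !rmorphM /= exprD.
  by rewrite H1 // H1' //; ring.
by rewrite H2 // H2' //; ring.
Qed.

End Eval.

(** * Laurent polynomials and exchange of one variable *)

Section FieldIdentities.
Variable L : fieldType.
Implicit Types (a e f m r y z : L).

Lemma mul3fK m y z : m != 0 -> z != 0 -> y = m * y * z * (m^-1 * z^-1).
Proof. by move=> m0 z0; field; rewrite z0. Qed.

Lemma expf_div_shift m y z e a N : y != 0 ->
  ((m * y * z) ^+ N.+1 * e + y * a) / y ^+ N.+1 =
  (m * z) ^+ N.+1 * e + a / y ^+ N.
Proof. by move=> y0; rewrite !exprMn !exprS; field; rewrite ?expf_neq0 ?y0. Qed.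

Lemma mulf2K f y r : y != 0 -> r != 0 -> f = f * (y * r) / y * r^-1.
Proof. by move=> y0 r0; field; rewrite y0 r0. Qed.

End FieldIdentities.

Section Laurent.
Variables (R : idomainType) (n : nat).
Local Notation A := {mpoly R[n]}.
Local Notation K := (Frat R n).
Implicit Types (p q a b F : A) (f g : K) (x y z : 'I_n -> K) (i j k l : 'I_n).
Implicit Types (m : 'X_{1..n}).

Lemma evalK_inj y p q : alg_indep y -> evalK y p = evalK y q -> p = q.
Proof.
by move=> yI E; apply/subr0_eq/yI; rewrite rmorphB /= E subrr.
Qed.

Lemma evalK_neq0 y p : alg_indep y -> p != 0 -> evalK y p != 0.
Proof. by move=> yI; apply: contra_neq => E; apply: yI. Qed.

Lemma alg_indep_neq0 y i : alg_indep y -> y i != 0.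
Proof. by move=> yI; rewrite -evalKXi; apply/evalK_neq0/mpolyX_neq0. Qed.

Definition mrem j m : 'X_{1..n} := [multinom if l == j then 0%N else m l | l < n].

Lemma mremE j m : mrem j m j = 0%N.
Proof. by rewrite mnmE eqxx. Qed.

Lemma mremN j l m : l != j -> mrem j m l = m l.
Proof. by move=> /negbTE lj; rewrite mnmE lj. Qed.

Lemma mpolyX_mrem j m : 'X_[m] = 'X_j ^+ m j * 'X_[mrem j m] :> A.
Proof.
rewrite mpolyXn -mpolyXD; congr 'X_[_]; apply/mnmP => l.
rewrite mnmDE mulmnE mnm1E mnmE eq_sym.
by case: eqP => [->|_]; rewrite ?mul1n ?addn0 ?mul0n.
Qed.

Lemma evalKXm_off y z j m : (forall l, l != j -> z l = y l) -> m j = 0%N ->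
  evalK z 'X_[m] = evalK y 'X_[m].
Proof.
move=> E mj; rewrite !evalKXm; apply: eq_bigr => l _.
by have [->|/E->//] := eqVneq l j; rewrite mj !expr0.
Qed.

Lemma evalK_off y z j F : (forall l, l != j -> z l = y l) -> zero_var j F = F ->
  evalK z F = evalK y F.
Proof.
move=> E <-; rewrite !evalK_zero_var; apply: eq_evalK => l; rewrite /setc.
by case: eqVneq => // /E.
Qed.

Lemma laurent_memE y f : laurent_mem y f <->
  exists p m, f * evalK y 'X_[m] = evalK y p.
Proof.
by split=> -[p [m E]]; exists p, m; move: E; rewrite evalKXm.
Qed.

Lemma eq_laurent_mem y z f : y =1 z -> laurent_mem y f -> laurent_mem z f.
Proof.
move=> E /laurent_memE[p [m H]]; apply/laurent_memE; exists p, m.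
by rewrite -!(eq_evalK E).
Qed.

Lemma laurent_evalK y p : laurent_mem y (evalK y p).
Proof. by apply/laurent_memE; exists p, 0%MM; rewrite mpolyX0 rmorph1 mulr1. Qed.

Lemma laurent_var y i : laurent_mem y (y i).
Proof. by rewrite -evalKXi; apply: laurent_evalK. Qed.

Lemma laurent_memD y f g : laurent_mem y f -> laurent_mem y g ->
  laurent_mem y (f + g).
Proof.
move=> /laurent_memE[p [m Ep]] /laurent_memE[q [m' Eq]]; apply/laurent_memE.
exists (p * 'X_[m'] + q * 'X_[m]), (m + m')%MM.
rewrite mpolyXD rmorphD !rmorphM /= -Ep -Eq; ring.
Qed.

Lemma laurent_memM y f g : laurent_mem y f -> laurent_mem y g ->
  laurent_mem y (f * g).
Proof.
move=> /laurent_memE[p [m Ep]] /laurent_memE[q [m' Eq]]; apply/laurent_memE.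
exists (p * q), (m + m')%MM.
rewrite mpolyXD !rmorphM /= -Ep -Eq; ring.
Qed.

Lemma laurent_memX y f d : laurent_mem y f -> laurent_mem y (f ^+ d).
Proof.
move=> fL; elim: d => [|d IHd]; last by rewrite exprS; apply: laurent_memM.
by rewrite expr0 -(rmorph1 (evalK y)); apply: laurent_evalK.
Qed.

Lemma laurent_monV y m : (forall i, y i != 0) ->
  laurent_mem y (evalK y 'X_[m])^-1.
Proof.
move=> y0; apply/laurent_memE; exists 1, m; rewrite rmorph1 mulVf // evalKXm.
by apply/prodf_neq0 => i _; rewrite expf_neq0.
Qed.

Lemma laurent_evalK_sub y z p : (forall i, laurent_mem y (z i)) ->
  laurent_mem y (evalK z p).
Proof.
move=> zL; elim/mpoly_alg_ind: p => [c|i|p q Lp Lq|p q Lp Lq].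
- by rewrite evalKC -(evalKC y); apply: laurent_evalK.
- by rewrite evalKXi.
- by rewrite rmorphD; apply: laurent_memD.
- by rewrite rmorphM; apply: laurent_memM.
Qed.

Lemma laurent_sub y z f : (forall i, z i != 0) ->
    (forall i, laurent_mem y (z i)) -> (forall i, laurent_mem y (z i)^-1) ->
  laurent_mem z f -> laurent_mem y f.
Proof.
move=> z0 zL zVL /laurent_memE[p [m E]].
have m0 : evalK z 'X_[m] != 0.
  by rewrite evalKXm; apply/prodf_neq0 => i _; rewrite expf_neq0.
have -> : f = evalK z p * (evalK z 'X_[m])^-1 by rewrite -E mulfK.
apply: laurent_memM; first exact: laurent_evalK_sub.
have -> : (evalK z 'X_[m])^-1 = evalK (fun i => (z i)^-1) 'X_[m].
  by rewrite !evalKXm -prodfV; apply: eq_bigr => i _; rewrite exprVn.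
exact: laurent_evalK_sub.
Qed.

Lemma ipow_expX j F N c : ipow 'X_j F 1 c -> ipow 'X_j F N (c ^+ N).
Proof.
by move=> Jc; elim: N => // N IHN; rewrite exprS -add1n; apply: ipowM.
Qed.

(** The exchange relation makes [F / y_j] a monomial in [z], which settles the term with [F^(N+1)];
    in the other term one [y_j] cancels. The monomial [m0] is the denominator of \hat F_j. *)
Lemma ipow_laurent y z j F m0 N p : alg_indep y -> admissible j F -> m0 j = 0%N ->
    (forall l, l != j -> z l = y l) ->
    evalK y 'X_[m0] * y j * z j = evalK y F ->
  ipow 'X_j F N p -> laurent_mem z (evalK y p / y j ^+ N).
Proof.
move=> yI Fg m0j zE zj.
have y0 i : y i != 0 by apply: alg_indep_neq0.
have F0 : evalK y F != 0 by apply: evalK_neq0 => //; apply: admissible_neq0 Fg.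
have zj0 : z j != 0 by apply: contraNneq F0 => E; rewrite -zj E mulr0.
have z0 i : z i != 0.
  by have [->|/zE->] := eqVneq i j; [exact: zj0 | exact: y0].
have m00 : evalK y 'X_[m0] != 0 by apply/evalK_neq0/mpolyX_neq0.
have yL i : laurent_mem z (y i).
  have [->|/zE<-] := eqVneq i j; last exact: laurent_var.
  have -> : y j = evalK z F * ((evalK z 'X_[m0])^-1 * (evalK z 'X_[U_(j)])^-1).
    rewrite (evalK_off zE Fg.1) (evalKXm_off zE m0j) evalKXi -zj.
    exact: (mul3fK (y j) m00 zj0).
  apply: laurent_memM; first exact: laurent_evalK.
  by apply: laurent_memM; apply: laurent_monV.
elim: N p => [|N IHN] p; first by rewrite divr1 => _; apply: laurent_evalK_sub.
move=> [e [a [-> /IHN aL]]].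
have -> : evalK y (F ^+ N.+1 * e + 'X_j * a) / y j ^+ N.+1 =
    (evalK z 'X_[m0] * z j) ^+ N.+1 * evalK y e + evalK y a / y j ^+ N.
  rewrite rmorphD !rmorphM rmorphXn /= evalKXi -zj (evalKXm_off zE m0j).
  exact: (expf_div_shift _ _ _ _ _ (y0 j)).
apply: laurent_memD => //; apply: laurent_memM; last exact: laurent_evalK_sub.
by apply/laurent_memX/laurent_memM; [apply: laurent_evalK | apply: laurent_var].
Qed.

(** Each [z_j] is the fraction [F / W]. Over the common denominator [W^d], every term of [q] has [d]
    factors [F] or [W], all of them in [(X_j, F)]. *)
Lemma laurent_homogenize y z j F m0 q : 
    (forall l, l != j -> z l = y l) ->
    evalK y 'X_[m0] * y j * z j = evalK y F ->
  exists d c, ipow 'X_j F d c /\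
    evalK z q * evalK y ('X_[m0] * 'X_j) ^+ d = evalK y c.
Proof.
move=> zE zj; set W := 'X_[m0] * 'X_j.
have JW d : ipow 'X_j F d (W ^+ d).
  by rewrite exprMn mulrC; apply: ipow_expx.
have zW : z j * evalK y W = evalK y F by rewrite rmorphM /= evalKXi -zj; ring.
clearbody W; elim/mpoly_alg_ind: q => [c|l|p q|p q].
- by exists 0%N, c%:MP; rewrite !evalKC mulr1.
- have [->|/zE E] := eqVneq l j; last first.
    by exists 0%N, 'X_l; rewrite !evalKXi mulr1 E.
  exists 1%N, F; split; last by rewrite evalKXi expr1.
  by exists 1, 0; rewrite mulr0 addr0 mulr1.
- move=> [d [c [Jc Ec]]] [d' [c' [Jc' Ec']]].
  exists (d + d')%N, (c * W ^+ d' + c' * W ^+ d); split.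
    by apply: ipowD; [| rewrite addnC]; apply: ipowM.
  by rewrite !rmorphD !rmorphM /= !rmorphXn /= exprD -Ec -Ec'; ring.
move=> [d [c [Jc Ec]]] [d' [c' [Jc' Ec']]].
exists (d + d')%N, (c * c'); split; first exact: ipowM.
by rewrite !rmorphM /= exprD -Ec -Ec'; ring.
Qed.

Lemma laurent_adjP y z j F m0 p m f : alg_indep y -> admissible j F -> m0 j = 0%N ->
    (forall l, l != j -> z l = y l) ->
    evalK y 'X_[m0] * y j * z j = evalK y F ->
    f * evalK y 'X_[m] = evalK y p ->
  laurent_mem z f <-> ipow 'X_j F (m j) p.
Proof.
move=> yI Fg m0j zE zj Ef.
have y0 i : y i != 0 by apply: alg_indep_neq0.
split=> [/laurent_memE[q [m1 E]]|Jp]; last first.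
  have F0 : evalK y F != 0 by apply: evalK_neq0 => //; apply: admissible_neq0 Fg.
  have zj0 : z j != 0 by apply: contraNneq F0 => E; rewrite -zj E mulr0.
  have z0 i : z i != 0.
  by have [->|/zE->] := eqVneq i j; [exact: zj0 | exact: y0].
  have r0 : evalK y 'X_[mrem j m] != 0 by apply/evalK_neq0/mpolyX_neq0.
  have -> : f = evalK y p / y j ^+ m j * (evalK z 'X_[mrem j m])^-1.
    rewrite -Ef (mpolyX_mrem j m) rmorphM rmorphXn /= evalKXi.
    rewrite (evalKXm_off zE (mremE j m)).
    exact: (mulf2K f (expf_neq0 _ (y0 j)) r0).
  by apply: laurent_memM (laurent_monV _ z0); apply: (ipow_laurent yI Fg m0j zE zj).
have [d [c [Jc Ec]]] := laurent_homogenize q zE zj.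
set W := 'X_[m0] * 'X_j in Ec.
(* The two expressions of [f], cleared of denominators in R[x]. The right side lies in the power
   [d + m1 j + m j]; on the left, [F^(m1 j)] and [X_j^d] cancel and the remaining monomials are
   regular. *)
have EA : F ^+ m1 j * ('X_j ^+ d * ('X_[mrem j m1] * 'X_[m0] ^+ d * p)) =
    c * ('X_[m0] ^+ m1 j * ('X_j ^+ m1 j *
      ('X_j ^+ m j * 'X_[mrem j m]))) :> A.
  apply: (evalK_inj yI); rewrite -mpolyX_mrem !rmorphM /= !rmorphXn /= !evalKXi.
  rewrite -Ef -Ec -E (mpolyX_mrem j m1) !rmorphM /= !rmorphXn /= !evalKXi -zj.
  by rewrite (evalKXm_off zE (mremE j m1)) !exprMn; ring.
have : ipow 'X_j F (m1 j + (d + m j)) (F ^+ m1 j *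
    ('X_j ^+ d * ('X_[mrem j m1] * 'X_[m0] ^+ d * p))).
  rewrite EA addnCA; apply: ipowM => //.
  by apply: ipowMr; apply: ipow_mulXx; apply: ipow_expx.
have X0 : 'X_j != 0 :> A by apply: mpolyX_neq0.
have regx := fun b => @admissible_regx R n j F b Fg.
move/(ipow_cancelXF X0 regx)/(ipow_cancelXx X0 regx).
apply: (ipow_cancel_reg X0 regx); apply: reg_modM; first exact/reg_mod_Xm/mremE.
by apply: reg_modX; apply: reg_mod_Xm.
Qed.

(** Substituting [x_k = Q / x'_k] creates only powers of [x'_k] as denominators, and [X_k] is
    regular modulo [(X_j, F')]. *)
Lemma evalK_clear_var x x' k j F' Q p : admissible j F' -> k != j ->
    (forall l, l != k -> x' l = x l) -> x k * x' k = evalK x' Q ->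
  exists u q, reg_mod 'X_j F' u /\ evalK x p * evalK x' u = evalK x' q.
Proof.
move=> Fg kj xE xk; elim/mpoly_alg_ind: p => [c|l|p q|p q].
- exists 1, c%:MP; split; first exact: reg_mod1.
  by rewrite !evalKC rmorph1 mulr1.
- have [->|/xE E] := eqVneq l k.
    exists 'X_k, Q; split; first exact: reg_mod_Xi.
    by rewrite !evalKXi xk.
  exists 1, 'X_l; split; first exact: reg_mod1.
  by rewrite !evalKXi rmorph1 mulr1 E.
- move=> [u [a [uR Ea]]] [v [b [vR Eb]]]; exists (u * v), (a * v + b * u).
  split; first exact: reg_modM.
  by rewrite !rmorphD !rmorphM /= -Ea -Eb; ring.
move=> [u [a [uR Ea]]] [v [b [vR Eb]]]; exists (u * v), (a * b).
split; first exact: reg_modM.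
by rewrite !rmorphM /= -Ea -Eb; ring.
Qed.

(** * Transfer of ideal powers between two clusters related by [x_k * x'_k = Q] *)

Section Transfer.
Variables (x x' : 'I_n -> K) (k j : 'I_n) (F F' Q u c : A).
Hypotheses (kj : k != j) (xI : alg_indep x') (Fg : admissible j F').
Hypotheses (xE : forall l, l != k -> x' l = x l).
Hypothesis xk : x k * x' k = evalK x' Q.
Hypotheses (QR : reg_mod 'X_j F' Q) (uR : reg_mod 'X_j F' u).
Hypotheses (Jc : ipow 'X_j F' 1 c) (uc : evalK x F * evalK x' u = evalK x' c).

(** Every factor [F] becomes [c], an element of [(X_j, F')], at the cost of the regular factor [u];
    the variable [x_j] is common to both clusters. *)
Lemma ipow_clear_var N p : ipow 'X_j F N p -> exists v q,
  [/\ reg_mod 'X_j F' v, ipow 'X_j F' N q & evalK x p * evalK x' v = evalK x' q].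
Proof.
elim: N p => [|N IHN] p.
  by have [v [q [vR E]]] := evalK_clear_var p Fg kj xE xk; exists v, q.
move=> [e [a [-> /IHN[v [q [vR Jq Eq]]]]]].
have [w [b [wR Eb]]] := evalK_clear_var e Fg kj xE xk.
exists (u ^+ N.+1 * (v * w)), (c ^+ N.+1 * (b * v) + 'X_j * (u ^+ N.+1 * w * q)).
split.
- by apply: reg_modM; [apply: reg_modX | apply: reg_modM].
- apply: ipowD; last by apply: ipow_mulx; apply: ipowMr.
  by rewrite mulrC; apply: ipowMr; apply: ipow_expX.
rewrite !rmorphD !rmorphM /= !rmorphXn /= -uc !evalKXi -Eb -Eq xE 1?eq_sym //.
by rewrite exprMn; ring.
Qed.

Lemma ipow_transfer p p' m m' f :
    f * evalK x 'X_[m] = evalK x p -> f * evalK x' 'X_[m'] = evalK x' p' ->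
  ipow 'X_j F (m j) p -> ipow 'X_j F' (m' j) p'.
Proof.
move=> Ep Ep' /ipow_clear_var[v [q [vR Jq Eq]]].
(* Both numerators of [f] compared in the variables [x']; the power of [Q] is [x_k^(m k)] multiplied
   by [x'_k^(m k)]. *)
have EA : 'X_j ^+ m j * (v * 'X_[mrem j (mrem k m)] * Q ^+ m k * p') =
    q * ('X_j ^+ m' j * 'X_[mrem j m']) * 'X_k ^+ m k :> A.
  have jk : j != k by rewrite eq_sym.
  rewrite -mpolyX_mrem; apply: (evalK_inj xI).
  rewrite !rmorphM /= !rmorphXn /= -Eq -Ep' -Ep -xk !evalKXi.
  rewrite (mpolyX_mrem k m) (mpolyX_mrem j (mrem k m)) mremN //.
  rewrite !rmorphM /= !rmorphXn /= !evalKXi xE // exprMn.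
  have -> : evalK x' 'X_[mrem j (mrem k m)] = evalK x 'X_[mrem j (mrem k m)].
    by apply: (evalKXm_off xE); rewrite mremN ?mremE.
  by ring.
have X0 : 'X_j != 0 :> A by apply: mpolyX_neq0.
have regx := fun b => @admissible_regx R n j F' b Fg.
have : ipow 'X_j F' (m j + m' j)
    ('X_j ^+ m j * (v * 'X_[mrem j (mrem k m)] * Q ^+ m k * p')).
  rewrite EA mulrC; apply: ipowMr; apply: ipowM => //.
  exact: ipow_expx.
move/(ipow_cancelXx X0 regx); apply: (ipow_cancel_reg X0 regx).
apply: reg_modM; last exact: reg_modX.
by apply: reg_modM => //; apply/reg_mod_Xm/mremE.
Qed.

End Transfer.
End Laurent.

(** * Involved variables *)

Section Involves.
Variables (R : idomainType) (n : nat).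
Local Notation A := {mpoly R[n]}.
Implicit Types (p q r : A) (i j k l : 'I_n) (m : 'X_{1..n}).

Lemma zero_varXm0 i m : (0 < m i)%N -> zero_var i ('X_[m] : A) = 0.
Proof.
move=> mi; rewrite (mpolyX_mrem R i) rmorphM rmorphXn /= zero_varXi eqxx.
by rewrite expr0n eqn0Ngt mi mul0r.
Qed.

Lemma mcoeff_zero_var i p m : (0 < m i)%N -> (zero_var i p)@_m = 0.
Proof.
move=> mi; elim/mpolyind: p => [|c m' p _ _ IHp]; first by rewrite raddf0 mcoeff0.
rewrite -mul_mpolyC raddfD /= rmorphM /= zero_varC mcoeffD IHp addr0 mcoeffCM.
have [/eqP m'i|m'i] := posnP (m' i); last by rewrite zero_varXm0 // mcoeff0 mulr0.
rewrite zero_varXm; last exact/eqP.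
rewrite mcoeffX; case: eqP => [E|_]; last by rewrite mulr0.
by rewrite -E (eqP m'i) in mi.
Qed.

Lemma not_involves i p : zero_var i p = p -> ~ involves p i.
Proof.
move=> <- [m [+ mi]]; by rewrite mcoeff_msupp mcoeff_zero_var // eqxx.
Qed.

(* View [p] as a polynomial in [X_i] and compare degrees. *)
Lemma zero_var_dvd i p q : p != 0 -> zero_var i p = p -> rdvd q p ->
  zero_var i q = q.
Proof.
move=> p0 Ep [r E].
pose th : A -> {poly A} := mmap (polyC \o @mpolyC n R)
  (fun l => if l == i then 'X else ('X_l)%:P).
have thM a b : th (a * b) = th a * th b by rewrite /th rmorphM.
have thD a b : th (a + b) = th a + th b by rewrite /th mmapD.
have thC c : th c%:MP = (c%:MP)%:P by rewrite /th mmapC.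
have thXi l : th 'X_l = if l == i then 'X else ('X_l)%:P by rewrite /th mmapX mmap1U.
have th0 : th 0 = 0 by rewrite /th mmap0.
clearbody th.
have thE t a : (th a).[t] = a \mPo [tuple (if l == i then t else 'X_l) | l < n].
  elim/mpoly_alg_ind: a => [c|l|a b Ea Eb|a b Ea Eb].
  - by rewrite thC hornerC comp_mpolyC.
  - rewrite thXi comp_mpolyXU -tnth_nth tnth_mktuple.
    by case: eqP => _; rewrite ?hornerX ?hornerC.
  - by rewrite thD hornerD comp_mpolyD Ea Eb.
  - by rewrite thM hornerM rmorphM /= Ea Eb.
have thX a : (th a).['X_i] = a.
  rewrite thE -[RHS]comp_mpoly_id; congr (_ \mPo _); apply: eq_from_tnth => l.
  by rewrite !tnth_mktuple; case: eqP => [->|].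
have th_inj a : a != 0 -> th a != 0.
  by apply: contra_neq => E0; rewrite -(thX a) E0 horner0.
have sp : (size (th p) <= 1)%N.
  rewrite -Ep.
  suff -> : th (zero_var i p) = (zero_var i p)%:P by apply: size_polyC_leq1.
  elim/mpoly_alg_ind: {E Ep p0} p => [c|l|a b Ea Eb|a b Ea Eb].
  - by rewrite zero_varC thC.
  - rewrite zero_varXi; case: eqP => [_|/eqP/negbTE li]; first by rewrite th0.
    by rewrite thXi li.
  - by rewrite raddfD /= thD Ea Eb polyCD.
  - by rewrite rmorphM /= thM Ea Eb polyCM.
have /andP[q0 r0] : (q != 0) && (r != 0) by rewrite -negb_or -mulf_eq0 -E.
have /size1_polyC Eq : (size (th q) <= 1)%N.
  apply: leq_trans sp; rewrite E thM size_mul ?th_inj //.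
  have : (0 < size (th r))%N by rewrite size_poly_gt0 th_inj.
  by case: (size (th r)) => // s _; rewrite addnS /= leq_addr.
by rewrite -[RHS]thX /zero_var -thE Eq !hornerC.
Qed.

Lemma zero_var_comm i j p : zero_var i (zero_var j p) = zero_var j (zero_var i p).
Proof.
apply: tofrac_inj; rewrite -!evalK_XK !evalK_zero_var; apply: eq_evalK => l.
by rewrite /setc; case: (l == i); case: (l == j).
Qed.

Lemma irreducible_not_dvdXi q l : irreducible_elt q -> ~ rdvd 'X_l q ->
  ~ rdvd q ('X_l).
Proof.
move=> [_ [qN _]] lq [r E]; have X0 : 'X_l != 0 :> A by apply: mpolyX_neq0.
have [|//|[s Es]] := @rdvdX_mul R n l q r; first by exists 1; rewrite mulr1.
case/negP: qN; apply: (rdvd_unit (unitr1 _)); exists s.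
by apply: (mulfI X0); rewrite mulr1 {1}E Es mulrCA.
Qed.

Lemma prime_not_dvdXm q m : prime_elt q -> q \isn't a GRing.unit ->
  (forall l, ~ rdvd q ('X_l)) -> ~ rdvd q ('X_[m]).
Proof.
move=> qP qN qX; rewrite mpolyXE_id; elim: (index_enum _) => [|l s IHs].
  by rewrite big_nil => /(rdvd_unit (unitr1 _)) qU; rewrite qU in qN.
rewrite big_cons => /qP[|//]; elim: (m l) => [|d IHd].
  by rewrite expr0 => /(rdvd_unit (unitr1 _)) qU; rewrite qU in qN.
by rewrite exprS => /qP[/qX|].
Qed.

End Involves.

(** * Adjacent clusters *)

Section Seeds.
Variables (R : idomainType) (n : nat).
Local Notation A := {mpoly R[n]}.
Local Notation K := (Frat R n).
Implicit Types (p q : A) (F : 'I_n -> A) (f : K) (x y z : 'I_n -> K).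
Implicit Types (i j k l : 'I_n) (m : 'X_{1..n}).

(** The denominator of \hat F_j. It is trivial at the original seed but left arbitrary at the
    mutated one. *)
Definition hat_monom F j : 'X_{1..n} :=
  [multinom if l == j then 0%N else hat_exp F j l | l < n].

Lemma hat_monomE y F j :
  \prod_(l < n | l != j) y l ^+ hat_exp F j l = evalK y 'X_[hat_monom F j].
Proof.
rewrite evalKXm big_mkcond; apply: eq_bigr => l _; rewrite mnmE.
by case: eqP => _; rewrite ?expr0.
Qed.

Lemma hat_monom_j F j : hat_monom F j j = 0%N.
Proof. by rewrite mnmE eqxx. Qed.

Lemma adj_clusterE y F j : alg_indep y ->
  evalK y 'X_[hat_monom F j] * y j * adj_cluster y F j j = evalK y (F j).
Proof.
move=> yI; rewrite /adj_cluster eqxx /hatF hat_monomE.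
have m0 : evalK y 'X_[hat_monom F j] != 0 by apply/evalK_neq0/mpolyX_neq0.
by rewrite mulrAC mulrA divfK ?alg_indep_neq0 // mulrCA divff // mulr1.
Qed.

Lemma adj_clusterN y F j l : l != j -> adj_cluster y F j l = y l.
Proof. by rewrite /adj_cluster => /negbTE->. Qed.

(** The clusters differ by a monomial in the common variables, which is invertible in both Laurent
    rings. *)
Lemma laurent_rescale y z k m f : alg_indep y -> m k = 0%N ->
    (forall l, l != k -> z l = y l) -> evalK y 'X_[m] * z k = y k ->
  laurent_mem z f <-> laurent_mem y f.
Proof.
move=> yI mk zE zk.
have y0 i : y i != 0 by apply: alg_indep_neq0.
have z0 i : z i != 0.
  have [->|/zE->] := eqVneq i k; last exact: y0.
  by apply/eqP => E; have := y0 k; rewrite -zk E mulr0 eqxx.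
have varV (w : 'I_n -> K) i : (forall l, w l != 0) -> laurent_mem w (w i)^-1.
  by move=> w0; rewrite -evalKXi; apply: laurent_monV.
have m0 : evalK y 'X_[m] != 0 by apply/evalK_neq0/mpolyX_neq0.
have Em : evalK z 'X_[m] = evalK y 'X_[m] by apply: evalKXm_off zE mk.
have zkE : z k = (evalK y 'X_[m])^-1 * y k by rewrite -zk mulKf.
split; apply: laurent_sub => // i; have [->|/zE E] := eqVneq i k.
- by rewrite zkE; apply: laurent_memM; [apply: laurent_monV | apply: laurent_var].
- by rewrite E; apply: laurent_var.
- rewrite zkE invfM invrK; apply: laurent_memM; first exact: laurent_evalK.
  exact: (varV y k y0).
- by rewrite E; exact: (varV y i y0).
- by rewrite -zk -Em; apply: laurent_memM; [apply: laurent_evalK | apply: laurent_var].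
- by rewrite -E; apply: laurent_var.
- rewrite -zk -Em invfM; apply: laurent_memM; first exact: laurent_monV.
  exact: (varV z k z0).
- by rewrite -E; exact: (varV z i z0).
Qed.

(** Cancelling [F_k] leaves a monomial whose value is 1, and algebraic independence forces its
    exponents to vanish. *)
Lemma hat_exp_eq0 x F j k : alg_indep x -> F k != 0 ->
  hatF x F k = evalK x (F k) -> j != k -> hat_exp F k j = 0%N.
Proof.
move=> xI Fk0 hF jk; have Fx0 : evalK x (F k) != 0 by apply: evalK_neq0.
have m0 : evalK x 'X_[hat_monom F k] != 0 by apply/evalK_neq0/mpolyX_neq0.
have : evalK x 'X_[hat_monom F k] = evalK x 1.
  apply: (mulfI Fx0); rewrite rmorph1 mulr1 -{1}hF /hatF hat_monomE divfK //.
move=> /(evalK_inj xI)/(congr1 (mcoeff (hat_monom F k))).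
rewrite mcoeffX eqxx mcoeff1; case: eqP => [/mnmP/(_ j)|_ /eqP].
  by rewrite !mnmE (negbTE jk).
by rewrite oner_eq0.
Qed.

Lemma Gsub_mod F j k : exists w, Gsub F k j = Pk F k j + F j * w.
Proof.
rewrite /Gsub /Pk; elim/mpoly_alg_ind: (F k) => [c|l|p q|p q].
- by exists 0; rewrite !comp_mpolyC mulr0 addr0.
- rewrite !comp_mpolyXU -!tnth_nth !tnth_mktuple; case: eqP => _.
    by exists 'X_j; rewrite add0r.
  by exists 0; rewrite mulr0 addr0.
- move=> [v Ev] [w Ew]; exists (v + w); rewrite !comp_mpolyD Ev Ew; ring.
move=> [v Ev] [w Ew]; rewrite !rmorphM /= Ev Ew.
set a := p \mPo _; set b := q \mPo _.
by exists (v * b + a * w + F j * v * w); ring.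
Qed.

Lemma zero_var_Gsub F j k : zero_var j (Gsub F k j) = Pk F k j.
Proof.
rewrite /Gsub /Pk; elim/mpoly_alg_ind: (F k) => [c|l|p q Ep Eq|p q Ep Eq].
- by rewrite !comp_mpolyC zero_varC.
- rewrite !comp_mpolyXU -!tnth_nth !tnth_mktuple; case: eqP => [_|/eqP/negbTE lj].
    by rewrite rmorphM /= zero_varXi eqxx mulr0.
  by rewrite zero_varXi lj.
- by rewrite !comp_mpolyD rmorphD /= Ep Eq.
- by rewrite !rmorphM /= Ep Eq.
Qed.

(** Exponent zero means that [F_j] does not divide [Gsub F k j], which is congruent to [Pk F k j]
    modulo [F_j]. *)
Lemma not_dvd_Pk F j k : factorial_domain A -> irreducible_elt (F j) ->
  Pk F k j != 0 -> hat_exp F k j = 0%N -> ~ rdvd (F j) (Pk F k j).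
Proof.
move=> fA [Fj0 [FjN _]] P0 h0 [c Ec].
have G0 : Gsub F k j != 0.
  by apply: contra_neq P0 => E; rewrite -zero_var_Gsub E raddf0.
(* [hat_exp] is chosen by [epsilon], so it is meaningful only once a maximal exponent exists;
   otherwise all powers of [F_j] would divide a nonzero polynomial. *)
have [a Ha] : exists a, hat_exp_spec F k j a.
  apply: NNPP => H; have [a []] := factorial_exp_dvd_bounded fA FjN G0.
  elim: a => [|a IHa]; first by exists (Gsub F k j); rewrite mul1r.
  by apply: NNPP => Na; apply: H; exists a.
have : hat_exp_spec F k j (hat_exp F k j).
  by apply: epsilon_spec; exists a.
rewrite h0 => -[_]; apply; have [w ->] := Gsub_mod F j k.
by exists (c + w); rewrite expr1 Ec mulrDr.
Qed.

End Seeds.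

(** * Mutation *)

Section Mutation.
Variables (R : idomainType) (n : nat).
Local Notation A := {mpoly R[n]}.
Local Notation K := (Frat R n).
Variables (x x' : 'I_n -> K) (F : 'I_n -> A) (k : 'I_n).
Hypothesis fA : factorial_domain A.
Hypothesis xI : alg_indep x.
Hypothesis Firr : forall i, irreducible_elt (F i).
Hypothesis FX : forall i l, ~ rdvd 'X_l (F i).
Hypothesis Finv : forall i, ~ involves (F i) i.
Hypothesis hatk : hatF x F k = evalK x (F k).
Hypothesis xE : forall l, l != k -> x' l = x l.
Hypothesis x'k : x' k = hatF x F k / x k.
Local Notation Q := (F k).

Lemma seed_admissible i : admissible i (F i).
Proof. by split; [apply: zero_var_notinvolves | apply: FX]. Qed.

Lemma evalK_Q : evalK x' Q = evalK x Q.
Proof. exact: evalK_notinvolves (@Finv k) xE. Qed.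

Lemma exchange : x k * x' k = evalK x' Q.
Proof.
by rewrite x'k hatk evalK_Q mulrC divfK ?alg_indep_neq0.
Qed.

(** A relation among the [x'] clears to a relation [q] among the [x], so [q = 0]. The substitution
    of [Q / X_k] for [X_k] is an involution, as [Q] is free of [X_k]; applying it again recovers
    [p = 0]. *)
Lemma mutated_indep : alg_indep x'.
Proof.
move=> p p0; have [d [q [r [e [_ H]]]]] := subst_fraction k Q 0 'X_k p.
have q0 : q = 0.
  apply: xI; have [Hq _] := H x (x' k).
  rewrite Hq; last by rewrite evalKXi exchange evalK_Q.
  have -> : evalK (setc k (x' k) x) p = evalK x' p.
    apply: eq_evalK => l; rewrite /setc.
    by have [->|/xE->] := eqVneq l k.
  by rewrite p0 mulr0.
have Q0 : Q%:F != 0 by rewrite tofrac_eq0; apply: admissible_neq0 (seed_admissible k).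
have X0 : XK R k != 0 by rewrite tofrac_eq0 mpolyX_neq0.
pose y : 'I_n -> K := setc k (Q%:F / XK R k) (@XK R n).
have yQ : evalK y Q = Q%:F.
  rewrite -evalK_XK; apply: evalK_notinvolves (@Finv k) _ => l /negbTE lk.
  by rewrite /y /setc lk.
have yk : y k = Q%:F / XK R k by rewrite /y /setc eqxx.
have yk0 : y k != 0 by rewrite yk; exact: (mulf_neq0 Q0 (invr_neq0 X0)).
have E : evalK (setc k (XK R k) y) p = 0.
  have [Hq _] := H y (XK R k); apply: (mulfI (expf_neq0 d yk0)).
  rewrite mulr0 -(evalKXi y) -Hq; first by rewrite q0 rmorph0.
  by rewrite evalKXi yQ yk (divfK X0).
apply: tofrac_inj; rewrite -evalK_XK tofrac0 -E; apply: eq_evalK => l.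
by rewrite /y /setc; case: eqP => [->|].
Qed.

Section Index.
Variable j : 'I_n.
Hypothesis jk : j != k.
Local Notation P := (Pk F k j).

Lemma Pk_zero_var : zero_var j P = P.
Proof. exact: zero_var_id. Qed.

Lemma Pk_neq0 : P != 0.
Proof. by apply/eqP => /rdvdX; apply: FX. Qed.

Lemma Pk_not_involves : ~ involves P k.
Proof.
apply: not_involves; rewrite [X in zero_var k X]/(zero_var j Q) zero_var_comm.
by rewrite (seed_admissible k).1.
Qed.

Lemma Q_split : exists w, Q = P + 'X_j * w.
Proof. exact: zero_var_mod. Qed.

Lemma not_dvd_seed_Pk : ~ rdvd (F j) P.
Proof.
apply: not_dvd_Pk => //; first exact: Pk_neq0.
by apply: (hat_exp_eq0 xI) => //; apply: admissible_neq0 (seed_admissible k).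
Qed.

Lemma reg_Q G : reg_mod 'X_j G P -> reg_mod 'X_j G Q.
Proof. by have [w Qw] := Q_split; apply: reg_mod_congr Qw. Qed.

(** [F_j] is prime and does not divide [P]; the latter rests on [hatk]. *)
Lemma reg_P : reg_mod 'X_j (F j) P.
Proof.
apply: reg_mod_coprime (seed_admissible j) _ => a b; rewrite Pk_zero_var => E.
have /(fA.2 _ (Firr j))[/not_dvd_seed_Pk//|//] : rdvd (F j) (P * a).
by exists b.
Qed.

(* Up to factors that are regular modulo the respective ideals, [F j] taken at
   [x] lies in [(X_j, G)] taken at [x'], and [G] taken at [x'] in [(X_j, F j)]
   taken at [x]. *)
Definition compatible (G : A) : Prop :=
  [/\ admissible j G, reg_mod 'X_j G P,
      exists u c, [/\ reg_mod 'X_j G u, ideal2 'X_j G c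
        & evalK x (F j) * evalK x' u = evalK x' c]
    & exists u c, [/\ reg_mod 'X_j (F j) u, ideal2 'X_j (F j) c
        & evalK x' G * evalK x u = evalK x c]].

(** Without [x_k], [F_j] has the same value at both clusters, and a unit does not change the
    ideal. *)
Lemma compatible_unit (u : R) : ~ involves (F j) k -> u \is a GRing.unit ->
  compatible (u%:MP * F j).
Proof.
move=> Fk uU.
have uU' : u%:MP \is a @GRing.unit A by rewrite rmorph_unit.
have Gg : admissible j (u%:MP * F j).
  split; first by rewrite rmorphM /= zero_varC (seed_admissible j).1.
  by move=> l /(rdvd_mulUl uU'); apply: FX.
have FE : evalK x' (F j) = evalK x (F j) by apply: evalK_notinvolves Fk xE.
split=> //.
- move=> y [b [c E]]; have [|b' [c' E']] := @reg_P y.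
    by exists b, (u%:MP * c); rewrite E; ring.
  exists b', (u%:MP^-1 * c'); rewrite E'; congr (_ + _).
  by rewrite mulrACA divrr // mul1r.
- exists u%:MP, (u%:MP * F j); split.
  + apply: reg_mod_dvd (@reg_mod1 _ _ _).
    by exists (u%:MP^-1); rewrite divrr.
  + by exists 0, 1; rewrite mulr0 add0r mulr1.
  by rewrite rmorphM /= FE mulrC.
exists 1, (u%:MP * F j); split; first exact: reg_mod1.
  by exists 0, u%:MP; rewrite mulr0 add0r mulrC.
by rewrite rmorph1 mulr1 !rmorphM /= !evalKC FE.
Qed.

(** * Exchange polynomials involving [x_k]: [q1] and [q2] clear [F_j] at [Q / X_k] and at
    [P / X_k] *)

Section Cleared.
Variables (G g : A) (ep en : 'X_{1..n}) (u : R) (d : nat) (q1 q2 e : A).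
Hypothesis uU : u \is a GRing.unit.
Hypothesis epj : ep j = 0%N.
Hypothesis enj : en j = 0%N.
Hypothesis g0 : g != 0.
Hypotheses (gj : ~ involves g j) (gk : ~ involves g k).
Hypothesis gP : exists m : nat, rdvd g (P ^+ m).
Hypothesis EG : (G * 'X_[en])%:F =
  (u%:MP * 'X_[ep])%:F * (Gmut F k j / g%:F).
Hypothesis GX : forall l, ~ rdvd 'X_l G.
Hypothesis E12 : q1 = q2 + (Q - P) * e.
Hypothesis H : forall y t,
  (evalK y 'X_k * t = evalK y Q ->
     evalK y q1 = evalK y 'X_k ^+ d * evalK (setc k t y) (F j)) /\
  (evalK y 'X_k * t = evalK y P ->
     evalK y q2 = evalK y 'X_k ^+ d * evalK (setc k t y) (F j)).

Lemma cleared_Gmut : q2%:F = XK R k ^+ d * Gmut F k j.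
Proof.
have X0 : XK R k != 0 by rewrite tofrac_eq0 mpolyX_neq0.
have [_] := H (@XK R n) (P%:F / XK R k); rewrite !evalK_XK => -> //.
by rewrite mulrC (divfK X0).
Qed.

(** The definition of [F'_j] freed of denominators, so that it can be evaluated at any cluster. *)
Lemma cleared_eq : G * 'X_[en] * g * 'X_k ^+ d = u%:MP * 'X_[ep] * q2.
Proof.
have gF0 : g%:F != 0 by rewrite tofrac_eq0.
apply: tofrac_inj; rewrite tofracM tofracXn tofracM EG.
by rewrite [RHS]tofracM cleared_Gmut -[in RHS](divfK gF0 (Gmut F k j)); ring.
Qed.

Lemma cleared_zero_var : zero_var j q2 = q2.
Proof.
apply: tofrac_inj; rewrite -!evalK_XK evalK_zero_var.
have X0 : XK R k != 0 by rewrite tofrac_eq0 mpolyX_neq0.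
have Xk : setc j 0 (@XK R n) k = XK R k by rewrite /setc eq_sym (negbTE jk).
have [_ H1] := H (setc j 0 (@XK R n)) (P%:F / XK R k).
have [_ H2] := H (@XK R n) (P%:F / XK R k).
rewrite H1; last first.
  by rewrite evalKXi Xk -evalK_zero_var Pk_zero_var evalK_XK mulrC (divfK X0).
rewrite H2; last by rewrite evalKXi evalK_XK mulrC (divfK X0).
rewrite !evalKXi Xk; congr (_ * _).
apply: evalK_notinvolves (@Finv j) _ => l /negbTE lj.
by rewrite /setc lj.
Qed.

Lemma mutated_admissible : admissible j G.
Proof.
split=> //; have := congr1 (zero_var j) cleared_eq.
rewrite !rmorphM /= rmorphXn /= cleared_zero_var (zero_varXm _ enj).
rewrite (zero_varXm _ epj) zero_varXi eq_sym (negbTE jk) zero_varC.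
rewrite (zero_var_notinvolves gj) -cleared_eq.
move/(mulIf (expf_neq0 d (mpolyX_neq0 R U_(k))))/(mulIf g0).
exact: (mulIf (mpolyX_neq0 R en)).
Qed.

Hypothesis HL : ldvd_k k 1 (Gmut F k j / g%:F).
Hypothesis Hred : forall q : A, irreducible_elt q -> ~ involves q j ->
  ~ involves q k -> rdvd q P -> ~ ldvd_k k q (Gmut F k j / g%:F).

(** A divisor of [P] involves neither [x_j] nor [x_k], so [Hred] applies to [q]. If [q] divided [G],
    it would divide a monomial times the numerator [Q1]; being no variable, it would divide [Q1],
    contrary to [Hred]. *)
Lemma mutated_not_dvd q : irreducible_elt q -> rdvd q P -> ~ rdvd q G.
Proof.
move=> qI qP [w Ew]; have qp := fA.2 _ qI; have [_ [qN _]] := qI.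
have dvdE i : zero_var i P = P -> ~ involves q i.
  by move=> Pi; apply/not_involves/(zero_var_dvd Pk_neq0 Pi qP).
have [d1 [Q1]] := HL; rewrite mul1r => EQ.
have E : G * 'X_[en] * 'X_k ^+ d1 = u%:MP * ('X_[ep] * Q1).
  apply: tofrac_inj; rewrite tofracM EG tofracXn -mulrA EQ -tofracM.
  by rewrite mulrA.
have qX l : ~ rdvd q 'X_l.
  apply: irreducible_not_dvdXi => // -[v Ev]; apply: (@GX l).
  by exists (v * w); rewrite Ew Ev mulrA.
have uU' : u%:MP \is a @GRing.unit A by rewrite rmorph_unit.
have /(rdvd_mulUl uU')/qp[] : rdvd q (u%:MP * ('X_[ep] * Q1)).
- by exists (w * 'X_[en] * 'X_k ^+ d1); rewrite -E Ew !mulrA.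
- exact: prime_not_dvdXm.
move=> [w1 Ew1]; apply: (Hred qI) qP _.
- by apply: dvdE; apply: Pk_zero_var.
- by apply: dvdE; apply: zero_var_notinvolves; apply: Pk_not_involves.
by exists d1, w1; rewrite EQ Ew1.
Qed.

Lemma mutated_reg_P : reg_mod 'X_j G P.
Proof.
apply: reg_mod_coprime mutated_admissible _ => a b; rewrite Pk_zero_var => E.
have [|w Ew] := @factorial_Gauss_dvd _ P G b fA Pk_neq0 mutated_not_dvd.
  by exists a.
by exists w; apply: (mulfI Pk_neq0); rewrite E Ew mulrCA.
Qed.

(** The value of [F_j] at [x] is that of [q1] at [x'] over a power of [x'_k]. Modulo [X_j], [q1]
    agrees with [q2], which [cleared_eq] relates to [G]. *)
Lemma seed_to_mutated : exists v c, [/\ reg_mod 'X_j G v, ideal2 'X_j G c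
  & evalK x (F j) * evalK x' v = evalK x' c].
Proof.
have [w Qw] := Q_split.
exists ('X_k ^+ d * (u%:MP * 'X_[ep])), (u%:MP * 'X_[ep] * q1); split.
- apply: reg_modM.
    by apply/reg_modX/(reg_mod_Xi mutated_admissible); rewrite eq_sym.
  apply: reg_modM; last exact: reg_mod_Xm mutated_admissible epj.
  apply: reg_mod_dvd (@reg_mod1 _ _ _).
  by exists (u^-1%:MP); rewrite -mpolyCM divrr.
- exists (u%:MP * 'X_[ep] * (w * e)), ('X_[en] * g * 'X_k ^+ d).
  by rewrite E12 mulrDr -cleared_eq {1}Qw; ring.
have [Hq _] := H x' (x k); rewrite !rmorphM /= Hq; last first.
  by rewrite evalKXi mulrC exchange.
have -> : evalK (setc k (x k) x') (F j) = evalK x (F j).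
  by apply: eq_evalK => l; rewrite /setc; case: (eqVneq l k) => [->|/xE].
by rewrite rmorphXn /=; ring.
Qed.

Lemma mutated_to_seed : exists v c, [/\ reg_mod 'X_j (F j) v, ideal2 'X_j (F j) c
  & evalK x' G * evalK x v = evalK x c].
Proof.
have [w Qw] := Q_split.
(* In the variables [x], [P / x'_k] is [P * x_k / Q]. Replacing [P] by [Q] there gives [x_k] itself,
   so [r2] is [F_j] times a power of [Q], and [r1] agrees with it modulo [X_j]. *)
have [d' [r1 [r2 [e' [E' H']]]]] := subst_fraction k (P * 'X_k) (Q * 'X_k) Q (F j).
have Er2 : r2 = Q ^+ d' * F j.
  apply: (evalK_inj xI); have [_ ->] := H' x (x k); last first.
    by rewrite rmorphM /= evalKXi.
  rewrite rmorphM rmorphXn /=; congr (_ * _); apply: eq_evalK => l.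
  by rewrite /setc; case: eqVneq => [->|].
have x'k0 : x' k != 0 by apply: alg_indep_neq0 mutated_indep.
have PE : evalK x' P = evalK x P.
  exact: evalK_notinvolves Pk_not_involves xE.
have gE : evalK x' g = evalK x g by exact: evalK_notinvolves gk xE.
pose t := evalK x P / x' k; pose Phi := evalK (setc k t x) (F j).
have Er1 : evalK x r1 = evalK x Q ^+ d' * Phi.
  have [-> //] := H' x t; rewrite rmorphM /= evalKXi -evalK_Q -exchange /t.
  rewrite mulrC mulrA mulrAC -(mulrA (evalK x P)) mulrC (mulrC (x k)) mulrA.
  by rewrite divfK // mulrC.
have Eq2 : evalK x' q2 = x' k ^+ d * Phi.
  have [_] := H x' t; rewrite evalKXi PE /t mulrC (divfK x'k0) => ->//.
  congr (_ * _); apply: eq_evalK => l; rewrite /setc.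
  by case: eqVneq => // /xE.
have EG1 : evalK x' G * evalK x' 'X_[en] * evalK x g =
    evalK x' u%:MP * evalK x' 'X_[ep] * Phi.
  apply: (mulIf (expf_neq0 d x'k0)).
  have := congr1 (evalK x') cleared_eq.
  rewrite !rmorphM /= rmorphXn /= Eq2 gE evalKXi => ->.
  by ring.
(* [EG1] with each [x'_k] replaced by [Q / x_k] and denominators cleared: [Q^(en k)] and
   [X_k^(ep k)] come from the monomials, [Q^d'] from [Phi]. *)
exists ('X_[mrem k en] * Q ^+ en k * 'X_k ^+ ep k * g * Q ^+ d').
exists (u%:MP * 'X_[mrem k ep] * Q ^+ ep k * 'X_k ^+ en k * r1); split.
- have QR : reg_mod 'X_j (F j) Q by apply/reg_Q/reg_P.
  apply: reg_modM; last exact: reg_modX.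
  apply: reg_modM; last first.
    by have [m gm] := gP; apply: reg_mod_dvd gm (reg_modX reg_P).
  apply: reg_modM; last first.
    by apply/reg_modX/(reg_mod_Xi (seed_admissible j)); rewrite eq_sym.
  apply: reg_modM; last exact: reg_modX.
  by apply: (reg_mod_Xm (seed_admissible j)); rewrite mremN.
- set c := u%:MP * _ * _ * _.
  exists (- (c * 'X_k * w * e')), (c * Q ^+ d').
  have EQ : P * 'X_k - Q * 'X_k = - ('X_j * w * 'X_k) by rewrite Qw; ring.
  by rewrite E' Er2 EQ; ring.
have X0 m : evalK x 'X_[mrem k m] = evalK x' 'X_[mrem k m].
  by apply/esym/(evalKXm_off xE)/mremE.
have := EG1; rewrite (mpolyX_mrem R k en) (mpolyX_mrem R k ep).
rewrite !rmorphM /= !rmorphXn /= !evalKXi Er1 !X0 -evalK_Q -exchange.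
rewrite !evalKC => E1.
have := congr1 ( *%R (x k ^+ en k * x k ^+ ep k * (x k * x' k) ^+ d')) E1.
rewrite !exprMn => E2.
by apply: etrans (etrans E2 _); ring.
Qed.

End Cleared.

Lemma mut_poly_compatible G : mut_poly F k j G -> compatible G.
Proof.
case=> [[Ejk _]|[[_ [Fk [u [uU ->]]]]|[_ [_ [g [ep [en [u]]]]]]]].
- by move: jk; rewrite Ejk eqxx.
- exact: compatible_unit.
move=> [uU [g0 [gj [gk [gP [HL [Hred [epj [enj [EG GX]]]]]]]]]].
have [d [q1 [q2 [e [E12 H]]]]] := subst_fraction k Q P 'X_k (F j).
split.
- exact: (mutated_admissible epj enj g0 gj EG GX H).
- exact: (mutated_reg_P uU epj enj g0 gj EG GX H HL Hred).
- exact: (seed_to_mutated uU epj enj g0 gj EG GX E12 H).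
- exact: (mutated_to_seed enj g0 gk gP EG H).
Qed.

(** Both memberships become ideal-power conditions on the numerators of [f]. The relation
    [x_k * x'_k = Q] is symmetric in the clusters, so [ipow_transfer] serves both directions. *)
Lemma laurent_adj_iff (G : A) (f : K) (z z' : 'I_n -> K) (m m' : 'X_{1..n}) :
    compatible G -> laurent_mem x f -> laurent_mem x' f ->
    m j = 0%N -> m' j = 0%N ->
    (forall l, l != j -> z l = x l) -> (forall l, l != j -> z' l = x' l) ->
    evalK x 'X_[m] * x j * z j = evalK x (F j) ->
    evalK x' 'X_[m'] * x' j * z' j = evalK x' G ->
  laurent_mem z f <-> laurent_mem z' f.
Proof.
move=> [Gg PR [u [c [uR cI uc]]] [v [b [vR bI vb]]]] fx fx' mj m'j zE z'E zj z'j.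
have /laurent_memE[p [r Ep]] := fx.
have /laurent_memE[p' [r' Ep']] := fx'.
have kj : k != j by rewrite eq_sym.
have xE' l : l != k -> x l = x' l by move=> /xE.
have xk' : x' k * x k = evalK x Q by rewrite mulrC exchange evalK_Q.
have QR : reg_mod 'X_j (F j) Q by apply/reg_Q/reg_P.
have A1 := laurent_adjP xI (seed_admissible j) mj zE zj Ep.
have A2 := laurent_adjP mutated_indep Gg m'j z'E z'j Ep'.
split=> [/A1 Jp|/A2 Jp]; [apply/A2|apply/A1].
  exact: (ipow_transfer kj mutated_indep Gg xE exchange (reg_Q PR) uR
    (ideal2_ipow cI) uc Ep Ep' Jp).
exact: (ipow_transfer kj xI (seed_admissible j) xE' xk' QR vR
  (ideal2_ipow bI) vb Ep' Ep Jp).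
Qed.

End Index.
End Mutation.

Theorem theorem4p8 (R : idomainType) (n : nat)
  (x : 'I_n -> Frat R n) (F : 'I_n -> {mpoly R[n]}) (k : 'I_n)
  (x' : 'I_n -> Frat R n) (F' : 'I_n -> {mpoly R[n]}) :
  UFD R -> contains_Z R ->
  LPseed x F ->
  (forall j : 'I_n, hatF x F j = evalK x (F j)) ->
  is_mutation x F k x' F' ->
  forall f : Frat R n, upper_bound x F f <-> upper_bound x' F' f.
Proof.
move=> ufdR _ [[xI _] [Firr [FX Finv]]] hat [x'E mutF] f.
have fA : factorial_domain {mpoly R[n]} by apply/mpoly_factorial/UFD_factorial.
have xE l : l != k -> x' l = x l by rewrite x'E => /negbTE->.
have x'k : x' k = hatF x F k / x k by rewrite x'E eqxx.
have x'I := mutated_indep xI FX Finv (hat k) xE x'k.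
have F'k : F' k = F k by have [[]|[[]|[]]] := mutF k.
(* In direction [k] the adjacent cluster of [x] is [x'] itself. *)
have adjk : laurent_mem (adj_cluster x F k) f <-> laurent_mem x' f.
  by split; apply: eq_laurent_mem => i; rewrite x'E.
(* Exchanging back from [x'] returns [x] up to the monomial denominator of \hat F'_k, since
   [F'_k = F_k]. *)
have adjk' : laurent_mem (adj_cluster x' F' k) f <-> laurent_mem x f.
  have hk := hat_monom_j F' k; set m := hat_monom F' k in hk.
  apply: (laurent_rescale _ xI hk) => [l lk|].
    by rewrite adj_clusterN // xE.
  have := adj_clusterE F' k x'I; rewrite F'k -(exchange xI Finv (hat k) xE x'k).
  rewrite (evalKXm_off xE hk) mulrAC mulrC [RHS]mulrC.
  exact: (mulfI (alg_indep_neq0 k x'I)).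
have adj j : laurent_mem x f -> laurent_mem x' f -> j != k ->
    laurent_mem (adj_cluster x F j) f <-> laurent_mem (adj_cluster x' F' j) f.
  move=> fx fx' jk.
  have cF' := mut_poly_compatible fA xI Firr FX Finv (hat k) xE x'k jk (mutF j).
  apply: (laurent_adj_iff fA xI Firr FX Finv (hat k) xE x'k jk cF' fx fx'
    (hat_monom_j F j) (hat_monom_j F' j)).
  - exact: adj_clusterN.
  - exact: adj_clusterN.
  - exact: adj_clusterE.
  exact: adj_clusterE.
split=> [[fx fz]|[fx' fz]].
  (* The condition in direction [k] supplies the Laurent expansion in the other cluster, which the
     comparison in the remaining directions requires. *)
  have fx' := adjk.1 (fz k); split=> // j.
  have [->|jk] := eqVneq j k; first by apply/adjk'.
  by apply/(adj j fx fx' jk)/fz.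
have fx := adjk'.1 (fz k); split=> // j.
have [->|jk] := eqVneq j k; first by apply/adjk.
by apply/(adj j fx fx' jk)/fz.
Qed.
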